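(* Let $C$ be an orientation of a cycle of even length. If $\gamma_C=1$ and $\alpha_C(2n_1,\ldots,2n_k)\ge 0$ for all positive integers $k$ and $n_1,\ldots,n_k$, then $C$ is quasirandom-forcing. Similarly, if $\gamma_C=-1$ and $\alpha_C(2n_1,\ldots,2n_k)\le 0$ for all positive integers $k$ and $n_1,\ldots,n_k$, then $C$ is quasirandom-forcing.
   Context: A kernel is a bounded measurable function $[0,1]^2\to\mathbb{R}$. A tournamenton is a non-negative kernel $W$ with $W(x,y)+W(y,x)=1$ for all $(x,y)$. For an oriented graph $H$ and a kernel $U$, $t(H,U)=\int_{[0,1]^{V(H)}}\prod_{vw\in E(H)}U(x_v,x_w)\,\mathrm{d}x_{V(H)}$; $\|H\|$ is the number of edges of $H$. $H$ is quasirandom-forcing if every tournamenton $W$ with $t(H,W)=2^{-\|H\|}$ equals $1/2$ almost everywhere. For a positive integer $n$, $Q_{2n}$ is the orientation of the path with $2n$ edges in which all edges are oriented away from the central vertex towards the two end vertices. For $n\ge 2$, $D_{2n}$ is the orientation of the cycle with $2n$ vertices obtained by choosing two opposite vertices and orienting all edges in the direction from one of them to the other. For an oriented cycle $C$ and $F\subseteq E(C)$, $C\langle F\rangle$ is the spanning subgraph of $C$ with edge set $F$. For positive integers $n_1,\ldots,n_k$, $\alpha_C(2n_1,\ldots,2n_k)$ is the number of sets $F\subseteq E(C)$ such that $C\langle F\rangle$ can be obtained from the vertex-disjoint union $Q_{2n_1}\cup\cdots\cup Q_{2n_k}$ by reversing an even number of edges and possibly adding isolated vertices, minus the number of sets $F\subseteq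 E(C)$ such that $C\langle F\rangle$ can be obtained from $Q_{2n_1}\cup\cdots\cup Q_{2n_k}$ by reversing an odd number of edges and possibly adding isolated vertices. If $C$ has even length $\ell$, $\gamma_C=+1$ if $C$ can be obtained from $D_\ell$ by reversing an even number of edges, and $\gamma_C=-1$ otherwise. *)

(* Defs.v *)
From HB Require Import structures.
From mathcomp Require Import all_boot all_order all_algebra.
From mathcomp Require Import zify.
From mathcomp Require Import all_classical all_reals all_analysis.

Set Implicit Arguments.
Unset Strict Implicit.
Unset Printing Implicit Defensive.

Import Order.TTheory GRing.Theory Num.Theory.
Import numFieldNormedType.Exports.

Local Open Scope classical_set_scope.
Local Open Scope ring_scope.

(** * Oriented graphs *)

(* The axiom also excludes loops (take [x = y]). *)
Record ograph := OGraph {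
  vert :> finType;
  arc : rel vert;
  arc_asym : forall x y, arc x y -> ~~ arc y x }.

Arguments arc {o}.

Definition edges (G : ograph) : {set G * G} := [set p | arc p.1 p.2]%SET.

Definition isomorphic (G H : ograph) : Prop :=
  exists2 f : G -> H, bijective f & forall x y, arc (f x) (f y) = arc x y.

Section Spanning.
Variables (G : ograph) (F : {set G * G}).

Definition span_arc : rel G := fun x y => arc x y && ((x, y) \in F).

Lemma span_arc_asym x y : span_arc x y -> ~~ span_arc y x.
Proof. by case/andP=> /arc_asym; rewrite /span_arc; case: (arc y x). Qed.

(* $G\langle F\rangle$; used with [F \subset edges G]. *)
Definition spanning : ograph := OGraph span_arc_asym.
End Spanning.

Section Reverse.
Variables (G : ograph) (X : {set G * G}).

Definition rev_arc : rel G := fun x y =>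
  arc x y && ((x, y) \notin X) || arc y x && ((y, x) \in X).

Lemma rev_arc_asym x y : rev_arc x y -> ~~ rev_arc y x.
Proof.
rewrite /rev_arc; have := @arc_asym G x y; have := @arc_asym G y x.
by do 2!case: arc => //=; case: (_ \in X); case: (_ \in X) => //= _ /(_ isT).
Qed.

(* [G] with the edges in [X] reversed; used with [X \subset edges G]. *)
Definition reverse : ograph := OGraph rev_arc_asym.
End Reverse.

Section DisjointUnion.
Variables G H : ograph.

Definition sum_arc : rel (G + H)%type := fun u v =>
  match u, v with
  | inl x, inl y => arc x y
  | inr x, inr y => arc x y
  | _, _ => false
  end.

Lemma sum_arc_asym u v : sum_arc u v -> ~~ sum_arc v u.
Proof. by case: u v => [x|x] [y|y] //=; apply: arc_asym. Qed.

Definition disjoint_union : ograph := OGraph sum_arc_asym.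
End DisjointUnion.

Definition no_arc m : rel 'I_m := fun _ _ => false.

Lemma no_arc_asym m (x y : 'I_m) : no_arc x y -> ~~ no_arc y x.
Proof. by []. Qed.

(* [m] isolated vertices. *)
Definition isolated (m : nat) : ograph := OGraph (@no_arc_asym m).

(* [H] arises from [G] by reversing a set of edges whose cardinality has parity
   [b] (true: odd). *)
Definition reversal (b : bool) (G H : ograph) : Prop :=
  exists X : {set G * G},
    [/\ X \subset edges G, odd #|X| = b & isomorphic H (reverse X)].

(* Same as [reversal], but isolated vertices may be added to [G]. *)
Definition reversal_isolated (b : bool) (G H : ograph) : Prop :=
  exists (X : {set G * G}) (m : nat),
    [/\ X \subset edges G, odd #|X| = b &
        isomorphic H (disjoint_union (reverse X) (isolated m))].

(** * Paths and cycles *)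

Section PathQ.
Variable n : nat.

Definition Q_arc : rel 'I_(n.*2.+1) := fun x y =>
  (n <= x)%N && (y == x.+1 :> nat) || (x <= n)%N && (x == y.+1 :> nat).

Lemma Q_arc_asym x y : Q_arc x y -> ~~ Q_arc y x.
Proof.
rewrite /Q_arc; lia.
Qed.

(* $Q_{2n}$: the vertices are numbered along the path, the central one is [n]. *)
Definition Q : ograph := OGraph Q_arc_asym.
End PathQ.

(* $Q_{2n_1}\cup\cdots\cup Q_{2n_k}$ for [s = [:: n_1; ...; n_k]]. *)
Definition Q_union (s : seq nat) : ograph :=
  foldr (fun n G => disjoint_union (Q n) G) (isolated 0) s.

Section CycleD.
Variable n : nat.

Definition D_arc : rel 'I_(n.*2) := fun x y =>
  (y == ordS x) && (x < n)%N || (x == ordS y) && (n <= y)%N.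

Lemma D_arc_asym x y : D_arc x y -> ~~ D_arc y x.
Proof.
have ordSE (u z : 'I_(n.*2)) :
    (u == ordS z) = (u == (if z.+1 < n.*2 then z.+1 else 0)%N :> nat).
  rewrite -val_eqE /=; case: ltnP => [/modn_small->//|zn].
  by rewrite (_ : z.+1 = n.*2) ?modnn//; have := ltn_ord z; lia.
rewrite /D_arc !ordSE; have := ltn_ord x; have := ltn_ord y.
by do 2!case: ifP; lia.
Qed.

(* $D_{2n}$: the vertices are numbered around the cycle, and the two opposite
   vertices are the source [0] and the sink [n]. *)
Definition D : ograph := OGraph D_arc_asym.
End CycleD.

(* An orientation of a cycle (of length $|V(C)|$). *)
Definition oriented_cycle (C : ograph) : Prop :=
  (3 <= #|C|)%N /\
  exists2 f : 'I_#|C| -> C, bijective f &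
    forall i j, arc (f i) (f j) || arc (f j) (f i)
                = (j == ordS i) || (i == ordS j).

(* $\alpha_C(2n_1,\dots,2n_k)$ for [s = [:: n_1; ...; n_k]]. *)
Definition alpha (C : ograph) (s : seq nat) : int :=
  let count b := #|[set F : {set C * C} | (F \subset edges C) &&
                     `[< reversal_isolated b (Q_union s) (spanning F) >]]%SET| in
  (count false)%:Z - (count true)%:Z.

Definition gamma (C : ograph) : int :=
  if `[< reversal false (D #|C|./2) C >] then 1 else -1.

(** * Kernels and densities *)

Section Densities.
Variable R : realType.

Local Notation mu := (@lebesgue_measure R).

Definition unit_itv : set (measurableTypeR R) := [set x | 0 <= x <= 1].
Definition unit_square : set (measurableTypeR R * measurableTypeR R) :=
  unit_itv `*` unit_itv.

(* Values outside the unit square are irrelevant. *)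
Definition kernel (U : measurableTypeR R * measurableTypeR R -> R) : Prop :=
  measurable_fun unit_square U /\
  exists M : R, forall p, unit_square p -> `|U p| <= M.

Definition tournamenton (W : measurableTypeR R * measurableTypeR R -> R) :
    Prop :=
  [/\ kernel W,
      forall p, unit_square p -> 0 <= W p &
      forall x y, unit_itv x -> unit_itv y -> W (x, y) + W (y, x) = 1].

Definition cons_pair n (p : measurableTypeR R * n.-tuple (measurableTypeR R)) :
  n.+1.-tuple (measurableTypeR R) := [tuple of p.1 :: p.2].

Lemma measurable_cons_pair n : measurable_fun setT (@cons_pair n).
Proof. exact: measurable_cons. Qed.

HB.instance Definition _ n := isMeasurableFun.Build _ _ _ _ (@cons_pair n)
  (@measurable_cons_pair n).

(* Lebesgue measure on $[0,1]^n$, as the $n$-fold product of the uniform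
   probability on $[0,1]$ (carried by [n]-tuples of reals). *)
Fixpoint cube_measure n : probability (n.-tuple (measurableTypeR R)) R :=
  match n with
  | 0 => dirac [tuple]
  | n.+1 => distribution (uniform_prob (@ltr01 R) \x cube_measure n)%E
              (@cons_pair n)
  end.

Definition unit_cube n : set (n.-tuple (measurableTypeR R)) :=
  [set x | forall i, unit_itv (tnth x i)].

(* $t(H,U)$; the vertex [v] is assigned the coordinate [enum_rank v]. *)
Definition density (H : ograph)
    (U : measurableTypeR R * measurableTypeR R -> R) : R :=
  \int[cube_measure #|H|]_(x in @unit_cube #|H|)
    \prod_(e in edges H)
      U (tnth x (enum_rank e.1), tnth x (enum_rank e.2)).

Definition quasirandom_forcing (H : ograph) : Prop :=
  forall W, tournamenton W -> density H W = 2 ^- #|edges H| ->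
    {ae (mu \x mu)%E, forall p, unit_square p -> W p = 1 / 2}.

End Densities.

(* Main.v *)
(* Write W = (1 + V) / 2, so that V is antisymmetric, and expand t(C, W) as
   2^-|E(C)| times the sum of t(C<F>, V) over F.  Reversing an edge changes the
   sign of t(-, V), hence t(C<F>, V) depends, up to sign, only on the underlying
   undirected graph.  For F <> E(C) this is a union of paths: a path with an odd
   number of edges has density 0 because its reflection reverses an odd number of
   edges, and t(Q_2n, V) is the integral of the square of V^n 1.  So the F with
   undirected graph Q_2n1 + ... + Q_2nk contribute alpha_C(2n1, ..., 2nk) times a
   nonnegative number, F empty contributes 1, and F = E(C) contributes gamma_C
   t(D_l, V), where t(D_l, V) is the squared Hilbert-Schmidt norm of V^(l/2).
   If t(C, W) = 2^-|E(C)|, everything else vanishes; in particular V^(l/2) = 0, and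
   V = 0 since V V f = 0 gives |V f|^2 = -<V V f, f> = 0 by antisymmetry. *)

From HB Require Import structures.
Require Import Defs.
From mathcomp Require Import all_boot all_order all_algebra.
From mathcomp Require Import zify ring lra.
From mathcomp Require Import all_classical all_reals all_analysis.
From mathcomp Require Import measurable_realfun.

Set Implicit Arguments.
Unset Strict Implicit.
Unset Printing Implicit Defensive.

Import Order.TTheory GRing.Theory Num.Theory.
Import numFieldNormedType.Exports.

Local Open Scope classical_set_scope.
Local Open Scope ring_scope.

(* Both names are shadowed by MathComp. *)
Local Notation arc := Defs.arc.
Local Notation isolated := Defs.isolated.

(** * Bounded measurable functions *)

Section BoundedMeasurable.
Context (R : realType).

(** No spectral theory is used: powers of V are stripped one factor at a time by skew-adjointness.
    Two points need care.

    A density is an integral over a cube with one coordinate per vertex, whereas the squares in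
    t(Q_2n, V) and t(D_l, V) appear only after the coordinates are regrouped. Independence is
    therefore stated for families indexed by any finite type, and each density is computed on the
    product space that fits its graph: two arms over a centre for Q, two inner paths over a pair of
    ends for D.

    The argument with V V f shows that V vanishes as an operator, hence that V has integral 0 over
    every rectangle. To conclude that V is 0 almost everywhere, 1 + V = 2 W is used as the density
    of a measure: it is nonnegative because W is, it agrees with the product measure on rectangles,
    and so it agrees with it on every measurable set. *)

(** This class is closed under sums, products, measurable substitution and partial integration, and
    its members are integrable for every probability, so Fubini applies throughout. *)
Definition bounded_mfun d (T : measurableType d) (f : T -> R) : Prop :=
  measurable_fun setT f /\ exists M : R, forall x, `|f x| <= M.

Lemma bounded_mfun_cst d (T : measurableType d) (c : R) :
  bounded_mfun (fun _ : T => c).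
Proof. by split; [exact: measurable_cst | exists `|c|]. Qed.

Lemma bounded_mfun_comp d (T : measurableType d) d' (T' : measurableType d')
    (f : T -> R) (g : T' -> T) :
  bounded_mfun f -> measurable_fun setT g -> bounded_mfun (f \o g).
Proof.
move=> [mf [M Mf]] mg; split; first exact: measurableT_comp.
by exists M => x; apply: Mf.
Qed.

Section OneSpace.
Context d (T : measurableType d).
Implicit Types (f g : T -> R).

Lemma bounded_mfunD f g :
  bounded_mfun f -> bounded_mfun g -> bounded_mfun (fun x => f x + g x).
Proof.
move=> [mf [M Mf]] [mg [N Ng]]; split; first exact: measurable_funD.
by exists (M + N) => x; rewrite (le_trans (ler_normD _ _))// lerD.
Qed.

Lemma bounded_mfunM f g :
  bounded_mfun f -> bounded_mfun g -> bounded_mfun (fun x => f x * g x).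
Proof.
move=> [mf [M Mf]] [mg [N Ng]]; split; first exact: measurable_funM.
by exists (M * N) => x; rewrite normrM ler_pM.
Qed.

Lemma bounded_mfun_prod (I : Type) (r : seq I) (Q : pred I) (F : I -> T -> R) :
  (forall i, bounded_mfun (F i)) ->
  bounded_mfun (fun x => \prod_(i <- r | Q i) F i x).
Proof.
move=> bF; elim: r => [|i r IH].
  under eq_fun do rewrite big_nil; exact: bounded_mfun_cst.
under eq_fun do rewrite big_cons.
by case: (Q i) => //; apply: bounded_mfunM.
Qed.

Lemma bounded_mfun_indic (A : set T) :
  measurable A -> bounded_mfun (\1_A : T -> R).
Proof.
move=> mA; split; first exact: measurable_indic.
by exists 1 => x; rewrite indicE; case: (_ \in _); rewrite ?normr1 ?normr0.
Qed.

Lemma bounded_mfun_integrable (P : probability T R) f :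
  bounded_mfun f -> P.-integrable setT (EFin \o f).
Proof.
move=> [mf [M Mf]]; apply: measurable_bounded_integrable => //.
  exact: fin_num_fun_lty.
by exists M; split; rewrite ?num_real// => r Mr x _; apply/ltW/(le_lt_trans (Mf x)).
Qed.

Lemma EFin_Rintegral (P : probability T R) f : bounded_mfun f ->
  (\int[P]_x f x)%:E = (\int[P]_x (f x)%:E)%E.
Proof.
move=> bf; rewrite fineK//.
exact: (integrable_fin_num measurableT (bounded_mfun_integrable P bf)).
Qed.

Lemma Rintegral_ge0_eq0 (P : probability T R) f :
  bounded_mfun f -> (forall x, 0 <= f x) -> \int[P]_x f x = 0 ->
  ae_eq P setT f (cst 0).
Proof.
move=> bf f0 If.
have : ae_eq P setT (fun x => (f x)%:E) (cst 0%:E).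
  apply/ae_eq_integral_abs => //; first by apply/measurable_EFinP; case: bf.
  under eq_integral do rewrite /= ger0_norm//.
  by rewrite -(EFin_Rintegral P bf) If.
by apply: filterS => x + _ => /(_ I) [].
Qed.

Lemma Rintegral_sqr_eq0 (P : probability T R) f : bounded_mfun f ->
  \int[P]_x (f x ^+ 2) = 0 -> ae_eq P setT f (cst 0).
Proof.
move=> bf /(Rintegral_ge0_eq0 (bounded_mfunM bf bf) (fun x => sqr_ge0 (f x))).
by apply: filterS => x + _ => /(_ I) /= /eqP; rewrite sqrf_eq0 => /eqP.
Qed.

Lemma ae_eq_Rintegral (P : probability T R) f g :
  bounded_mfun f -> bounded_mfun g -> ae_eq P setT f g ->
  \int[P]_x f x = \int[P]_x g x.
Proof.
move=> [mf _] [mg _] fg; congr fine; apply: ae_eq_integral => //.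
- exact/measurable_EFinP.
- exact/measurable_EFinP.
by apply: filterS fg => x h /h /= ->.
Qed.

Lemma Rintegral_bound (P : probability T R) f (M : R) :
  bounded_mfun f -> (forall x, `|f x| <= M) -> `|\int[P]_x f x| <= M.
Proof.
move=> bf fM; have bfi := bounded_mfun_integrable P bf.
apply: (le_trans (le_normr_Rintegral _ bfi)) => //.
have -> : M = \int[P]_x M.
  by rewrite Rintegral_cst// [fine _](congr1 fine (probability_setT P)) mulr1.
apply: le_Rintegral => //; first exact: integrable_norm.
exact: (bounded_mfun_integrable P (bounded_mfun_cst _ _)).
Qed.

Lemma bounded_mfun_sum (I : Type) (r : seq I)
    (p : pred I) (F : I -> T -> R) : (forall i, bounded_mfun (F i)) ->
  bounded_mfun (fun x => \sum_(i <- r | p i) F i x).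
Proof.
move=> bF; elim: r => [|i r IH].
  under eq_fun do rewrite big_nil; exact: bounded_mfun_cst.
under eq_fun do rewrite big_cons.
by case: (p i) => //; apply: bounded_mfunD.
Qed.

Lemma Rintegral_sum (Q : probability T R) (I : Type)
    (r : seq I) (p : pred I) (F : I -> T -> R) : (forall i, bounded_mfun (F i)) ->
  \int[Q]_x (\sum_(i <- r | p i) F i x) = \sum_(i <- r | p i) \int[Q]_x F i x.
Proof.
move=> bF.
elim: r => [|i r IH].
  by under eq_Rintegral do rewrite big_nil; rewrite Rintegral_cst// mul0r big_nil.
under eq_Rintegral do rewrite big_cons; rewrite big_cons; case: (p i) => //.
rewrite RintegralD ?IH//; apply: bounded_mfun_integrable => //.
exact: bounded_mfun_sum.
Qed.

End OneSpace.

Lemma Rintegral_pushforward d1 d2 (T1 : measurableType d1)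
    (T2 : measurableType d2) (P : probability T1 R) (Q : probability T2 R)
    (phi : T1 -> T2) (f : T2 -> R) :
  measurable_fun setT phi ->
  (forall A, measurable A -> P (phi @^-1` A) = Q A) ->
  bounded_mfun f -> \int[Q]_y f y = \int[P]_x f (phi x).
Proof.
move=> mphi PQ bf; congr fine.
transitivity (\int[pushforward P phi]_y (f y)%:E)%E.
  by apply: eq_measure_integral => A mA _; first [exact: PQ | exact/esym/PQ].
rewrite integral_pushforward//.
- by apply/measurable_EFinP; case: bf.
- by rewrite preimage_setT; apply: (bounded_mfun_integrable P (bounded_mfun_comp bf mphi)).
Qed.

Section Fubini.
Context d1 d2 (T1 : measurableType d1) (T2 : measurableType d2).
Context (P1 : probability T1 R) (P2 : probability T2 R).
Implicit Type f : T1 * T2 -> R.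

(** The type annotation gives the product its structure of a probability, so that the lemmas on
    probabilities apply to it again. *)
Definition prod_prob : probability (T1 * T2)%type R := (P1 \x P2)%E.

Lemma bounded_mfun_slice1 f x : bounded_mfun f -> bounded_mfun (fun y => f (x, y)).
Proof. by move=> bf; apply: (bounded_mfun_comp bf); apply: pair1_measurable. Qed.

Lemma bounded_mfun_slice2 f y : bounded_mfun f -> bounded_mfun (fun x => f (x, y)).
Proof. by move=> bf; apply: (bounded_mfun_comp bf); apply: pair2_measurable. Qed.

Lemma bounded_mfun_int2 f : bounded_mfun f ->
  bounded_mfun (fun x => \int[P2]_y f (x, y)).
Proof.
move=> bf; split; last first.
  have [_ [M Mf]] := bf; exists M => x; apply: Rintegral_bound => //.
  exact: bounded_mfun_slice1.
apply/measurable_EFinP; rewrite (_ : EFin \o _ = fubini_F P2 (EFin \o f)); last first.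
  by apply/funext => x; exact: (EFin_Rintegral P2 (bounded_mfun_slice1 x bf)).
apply: (@measurable_fubini_F _ _ _ _ _ P1 P2 (EFin \o f)).
exact: (bounded_mfun_integrable (P1 \x P2)%E bf).
Qed.

Lemma bounded_mfun_int1 f : bounded_mfun f ->
  bounded_mfun (fun y => \int[P1]_x f (x, y)).
Proof.
move=> bf; split; last first.
  have [_ [M Mf]] := bf; exists M => x; apply: Rintegral_bound => //.
  exact: bounded_mfun_slice2.
apply/measurable_EFinP; rewrite (_ : EFin \o _ = fubini_G P1 (EFin \o f)); last first.
  by apply/funext => x; exact: (EFin_Rintegral P1 (bounded_mfun_slice2 x bf)).
apply: (@measurable_fubini_G _ _ _ _ _ P1 P2 (EFin \o f)).
exact: (bounded_mfun_integrable (P1 \x P2)%E bf).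
Qed.

Lemma Rintegral_prod12 f : bounded_mfun f ->
  \int[prod_prob]_z f z = \int[P1]_x \int[P2]_y f (x, y).
Proof.
move=> bf; apply: (@EFin_inj R).
rewrite (EFin_Rintegral prod_prob bf) (EFin_Rintegral P1 (bounded_mfun_int2 bf)).
rewrite -(@integral12_prod_meas1 _ _ _ _ _ P1 P2 (EFin \o f)).
  by apply: eq_integral => x _; apply/esym/(EFin_Rintegral P2 (bounded_mfun_slice1 x bf)).
exact: (bounded_mfun_integrable (P1 \x P2)%E bf).
Qed.

Lemma Rintegral_prod21 f : bounded_mfun f ->
  \int[prod_prob]_z f z = \int[P2]_y \int[P1]_x f (x, y).
Proof.
move=> bf; apply: (@EFin_inj R).
rewrite (EFin_Rintegral prod_prob bf) (EFin_Rintegral P2 (bounded_mfun_int1 bf)).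
rewrite -(@integral21_prod_meas1 _ _ _ _ _ P1 P2 (EFin \o f)).
  by apply: eq_integral => x _; apply/esym/(EFin_Rintegral P1 (bounded_mfun_slice2 x bf)).
exact: (bounded_mfun_integrable (P1 \x P2)%E bf).
Qed.

End Fubini.
Arguments prod_prob {d1 d2 T1 T2} P1 P2.

End BoundedMeasurable.

(** * Independent uniform variables *)

Section IID.
Context (R : realType).
Local Notation T := (measurableTypeR R).
Local Notation P := (uniform_prob (@ltr01 R)).

(* Stated on rectangles, which determine the joint law (see [iid_law]). *)
Definition iid d (Om : measurableType d) (Pr : probability Om R) (I : finType)
    (X : I -> Om -> T) : Prop :=
  (forall i, measurable_fun setT (X i)) /\
  forall A : I -> set T, (forall i, measurable (A i)) ->
    Pr [set w | forall i, A i (X i w)] = (\prod_i fine (P (A i)))%:E.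

Lemma measurable_forall_fin d (Om : measurableType d) (I : finType)
    (X : I -> Om -> T) (A : I -> set T) :
  (forall i, measurable_fun setT (X i)) -> (forall i, measurable (A i)) ->
  measurable [set w | forall i, A i (X i w)].
Proof.
move=> mX mA.
rewrite (_ : mkset _ = \bigcap_(i in [set: I]) (X i @^-1` A i)); last first.
  by apply/seteqP; split => w /= h i; [move=> _; exact: h | exact: h].
apply: fin_bigcap_measurable; first exact: finite_finset.
by move=> i _; rewrite -[X in measurable X]setTI; apply: mX.
Qed.

Lemma iid_id : iid P (fun (_ : 'I_1) x => x).
Proof.
split=> [_|A mA]; first exact: measurable_id.
rewrite big_ord1 fineK ?fin_num_measure//; congr (P _).
by apply/seteqP; split => x /= => [/(_ ord0)|? i]; rewrite ?(ord1 i).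
Qed.

Lemma iid_reindex d (Om : measurableType d) (Pr : probability Om R)
    (I K : finType) (X : I -> Om -> T) (g : K -> I) :
  bijective g -> iid Pr X -> iid Pr (fun k => X (g k)).
Proof.
move=> bg [mX hX]; have [h gK hK] := bg; split=> [k|A mA]; first exact: mX.
have -> : [set w | forall k, A k (X (g k) w)] = [set w | forall i, A (h i) (X i w)].
  by apply/seteqP; split => w /= H i; [rewrite -{2}(hK i) | rewrite -{1}(gK i)]; apply: H.
rewrite (hX (fun i => A (h i))); last by move=> i; apply: mA.
rewrite (reindex g) /=; last exact: onW_bij.
by under eq_bigr do rewrite gK.
Qed.

(** Sum types index both the vertices of a disjoint union and the pieces into which [Q n] and [D n]
    are cut. *)
Lemma iid_sum d1 d2 (T1 : measurableType d1) (T2 : measurableType d2)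
    (P1 : probability T1 R) (P2 : probability T2 R) (I J : finType)
    (X : I -> T1 -> T) (Y : J -> T2 -> T) :
  iid P1 X -> iid P2 Y ->
  iid (prod_prob P1 P2) (fun (u : I + J) w =>
    match u with inl i => X i w.1 | inr j => Y j w.2 end).
Proof.
move=> [mX hX] [mY hY]; split=> [[i|j]|A mA].
- exact: measurableT_comp.
- exact: measurableT_comp.
have -> : [set w | forall u, A u (match u with inl i => X i w.1 | inr j => Y j w.2 end)]
    = [set w | forall i, A (inl i) (X i w)] `*` [set w | forall j, A (inr j) (Y j w)].
  apply/seteqP; split => w /=; first by move=> H; split => i; apply: H.
  by case=> H1 H2 [i|j].
rewrite [LHS]product_measure1E;
  [ | by apply: (@measurable_forall_fin _ _ _ _ (A \o inl)) => // i; apply: mA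
    | by apply: (@measurable_forall_fin _ _ _ _ (A \o inr)) => // i; apply: mA].
rewrite [X in (X * _)%E](hX (fun i => A (inl i))); last by move=> i; apply: mA.
rewrite [X in (_ * X)%E](hY (fun j => A (inr j))); last by move=> i; apply: mA.
by rewrite big_sumType.
Qed.

Lemma iid_tnth n : iid (cube_measure R n) (fun (i : 'I_n) x => tnth x i).
Proof.
split=> [i|]; first exact: measurable_tnth.
elim: n => [|n IH] A mA.
  rewrite big_ord0 (_ : mkset _ = setT); first exact: probability_setT.
  by apply/seteqP; split => // x _ [].
rewrite /= /pushforward/=.
rewrite (_ : _ @^-1` _ = A ord0 `*` [set y | forall i, A (lift ord0 i) (tnth y i)]); last first.
  apply/seteqP; split => -[x y] /=.
    move=> H; split => [|i]; first exact: (H ord0).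
    by have := H (lift ord0 i); rewrite tnthS.
  by move=> [H1 H2] i; case: (unliftP ord0 i) => [j|] ->; rewrite ?tnthS.
rewrite [LHS]product_measure1E//; last first.
  apply: (@measurable_forall_fin _ _ _ _ (A \o lift ord0)) => // i; last exact: mA.
  exact: measurable_tnth.
rewrite [X in (_ * X)%E](IH (fun i => A (lift ord0 i))) // big_ord_recl EFinM fineK//.
exact: fin_num_measure.
Qed.

Definition tuple_box n (A : 'I_n -> set T) : set (n.-tuple T) :=
  [set x | forall i, A i (tnth x i)].

(** The preimages under single coordinates generate the sigma-algebra but are not closed under
    intersection. Boxes are, as uniqueness of measures demands. *)
Lemma measurable_tuple_box n :
  @measurable _ (n.-tuple T) =
  <<s [set B | exists2 A : 'I_n -> set T, (forall i, measurable (A i)) & B = tuple_box A] >>.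
Proof.
apply/seteqP; split.
  apply: smallest_sub; first exact: smallest_sigma_algebra.
  move=> B; rewrite -bigcup_seq /= => -[i _ [A mA <-]].
  (* A condition on coordinate [i] alone is a box with full sides elsewhere. *)
  apply: sub_sigma_algebra; exists (fun j => if j == i then A else setT).
    by move=> j; case: ifP.
  rewrite setTI; apply/seteqP; split => x /=; last by move=> /(_ i); rewrite eqxx.
  by move=> Ax j; case: eqP => [->|].
apply: smallest_sub; first exact: sigma_algebra_measurable.
move=> _ [A mA ->]; apply: measurable_forall_fin => // i; exact: measurable_tnth.
Qed.

(** Boxes form a generating family stable under intersection, so two probabilities that agree on
    them are equal. *)
Lemma iid_law d (Om : measurableType d) (Pr : probability Om R) n
    (X : 'I_n -> Om -> T) : iid Pr X ->
  measurable_fun setT (fun w => [tuple X i w | i < n]) /\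
  forall A, measurable A ->
    Pr ((fun w => [tuple X i w | i < n]) @^-1` A) = cube_measure R n A.
Proof.
move=> [mX hX].
have mphi : measurable_fun setT (fun w => [tuple X i w | i < n]).
  apply/measurable_fun_tnthP => i; rewrite (_ : _ \o _ = X i)//.
  by apply/funext => w /=; rewrite tnth_mktuple.
split=> // A mA.
have [mt ht] := iid_tnth n.
apply: (measure_unique _ (fun _ => setT) (@measurable_tuple_box n) _ _ _
  (pushforward Pr (fun w => [tuple X i w | i < n])) (cube_measure R n)) => //.
- move=> _ _ [A1 mA1 ->] [A2 mA2 ->]; exists (fun i => A1 i `&` A2 i).
    by move=> i; apply: measurableI.
  apply/seteqP; split => x /=; first by case=> h1 h2 i; split.
  by move=> h; split => i; case: (h i).
- by move=> _; exists (fun=> setT) => //; apply/seteqP; split.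
- by apply/seteqP; split => // x _; exists 0%N.
- move=> _ [B mB ->]; rewrite [RHS]ht// -(hX _ mB) /pushforward; congr (Pr _).
  by apply/seteqP; split => w /= H i; have := H i; rewrite tnth_mktuple.
- by move=> _; rewrite /= /pushforward preimage_setT probability_setT ltry.
Qed.

Lemma measurable_unit_itv : measurable (@unit_itv R).
Proof.
rewrite (_ : @unit_itv R = `[0, 1]%classic); first exact: measurable_itv.
by apply/seteqP; split => x; rewrite /= in_itv.
Qed.

Lemma uniform_unit_itv : P (@unit_itv R) = 1%E.
Proof.
apply: (@integral_uniform_pdf1 R 0 1 (@unit_itv R) ltr01) => x /=.
by rewrite in_itv.
Qed.

Lemma measurable_unit_cube n : measurable (@unit_cube R n).
Proof.
apply: (@measurable_forall_fin _ _ _ (fun i x => tnth x i) (fun _ => @unit_itv R)) => i.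
  exact: measurable_tnth.
exact: measurable_unit_itv.
Qed.

Lemma cube_measure_unit_cube n : cube_measure R n (@unit_cube R n) = 1%E.
Proof.
have [_ /(_ (fun _ => @unit_itv R)) ->] := iid_tnth n; last by move=> _; exact: measurable_unit_itv.
rewrite big1// => i _; exact: (congr1 fine uniform_unit_itv).
Qed.

Lemma eq_density (H : ograph) (U U' : T * T -> R) :
  (forall p, @unit_square R p -> U p = U' p) -> density H U = density H U'.
Proof.
move=> UU'; apply: eq_Rintegral => x; rewrite inE => cx.
by apply: eq_bigr => e _; apply: UU'; split; apply: cx.
Qed.

Definition arc_prod (H : ograph) (V : T * T -> R) (x : H -> T) : R :=
  \prod_(e in edges H) V (x e.1, x e.2).

Lemma bounded_mfun_arc_prod d (Om : measurableType d) (H : ograph)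
    (V : T * T -> R) (X : H -> Om -> T) : bounded_mfun V ->
  (forall v, measurable_fun setT (X v)) ->
  bounded_mfun (fun w => arc_prod V (X^~ w)).
Proof.
move=> bV mX; apply: bounded_mfun_prod => e.
apply: (bounded_mfun_comp (g := fun w => (X e.1 w, X e.2 w)) bV).
exact: measurable_fun_pair.
Qed.

(** This frees the density from the fixed cube: any probability space with one independent uniform
    variable per vertex will do. *)
Lemma density_iid (H : ograph) (V : T * T -> R) d (Om : measurableType d)
    (Pr : probability Om R) (X : H -> Om -> T) :
  bounded_mfun V -> iid Pr X -> density H V = \int[Pr]_w arc_prod V (X^~ w).
Proof.
move=> bV iX.
have [mphi lphi] := iid_law (iid_reindex (@enum_val_bij H) iX).
have bF : bounded_mfun (fun x : #|H|.-tuple T =>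
    arc_prod V (fun v => tnth x (enum_rank v))).
  by apply: bounded_mfun_arc_prod => // v; exact: measurable_tnth.
transitivity (\int[cube_measure R #|H|]_x arc_prod V (fun v => tnth x (enum_rank v))).
  (* Restricting to the unit cube changes nothing, because its complement has measure 0. *)
  rewrite /density Rintegral_mkcond; apply: ae_eq_Rintegral => //.
    rewrite (_ : patch _ _ _ = fun x : #|H|.-tuple T => \1_(@unit_cube R #|H|) x *
      arc_prod V (fun v => tnth x (enum_rank v))).
      apply: bounded_mfunM => //; apply: bounded_mfun_indic; exact: measurable_unit_cube.
    apply/funext => x; rewrite patchE indicE; case: (_ \in _) => /=.
      by rewrite mul1r.
    by rewrite mul0r.
  exists (~` @unit_cube R #|H|); split.
  - apply: measurableC; exact: measurable_unit_cube.
  - rewrite [LHS]probability_setC; last exact: measurable_unit_cube.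
    by rewrite [X in (1 - X)%E]cube_measure_unit_cube subee.
  - move=> x /= /not_implyP[_]; apply: contra_not => cx.
    by rewrite patchE mem_set.
rewrite (Rintegral_pushforward mphi lphi bF).
apply: eq_Rintegral => w _; congr (arc_prod V _); apply/funext => v.
by rewrite tnth_mktuple enum_rankK.
Qed.

End IID.

(** * Undirected isomorphism *)

Definition uadj (G : ograph) : rel G := fun x y => arc x y || arc y x.

Definition uiso (G H : ograph) : Prop :=
  exists2 f : G -> H, bijective f & forall x y, uadj (f x) (f y) = uadj x y.

Lemma uiso_refl G : uiso G G.
Proof. by exists id => //; exact: (inv_bij (fun=> erefl)). Qed.

Lemma uiso_sym G H : uiso G H -> uiso H G.
Proof.
case=> f [g fK gK] ff; exists g; first by exists f.
by move=> x y; rewrite -ff !gK.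
Qed.

Lemma uiso_trans G H K : uiso G H -> uiso H K -> uiso G K.
Proof.
case=> f bf ff [g bg gg]; exists (g \o f); first exact: bij_comp.
by move=> x y /=; rewrite gg ff.
Qed.

Lemma isomorphic_uiso G H : isomorphic G H -> uiso G H.
Proof. by case=> f bf ff; exists f => // x y; rewrite /uadj !ff. Qed.

Lemma uiso_reverse (G : ograph) (X : {set G * G}) : uiso (reverse X) G.
Proof.
exists id; first exact: (inv_bij (fun=> erefl)).
move=> x y; rewrite /uadj /= /rev_arc.
by do 2![case: arc => //=]; do 2![case: (_ \in X) => //=].
Qed.

(** Reverse exactly those arcs of [G] whose direction disagrees with [H]. The parity of their number
    depends on the chosen isomorphism, hence the existential. *)
Lemma uiso_reversal (G H : ograph) : uiso H G -> exists b, reversal b G H.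
Proof.
case=> f [g fK gK] ff.
pose X := [set e | arc e.1 e.2 && ~~ arc (g e.1) (g e.2)]%SET.
exists (odd #|X|), X; split => //.
  by apply/fintype.subsetP => e; rewrite !inE => /andP[].
exists f; first by exists g.
move=> x y; rewrite /= /rev_arc !inE /= !fK.
have := ff x y; rewrite /uadj.
have := @arc_asym G (f x) (f y); have := @arc_asym H x y; have := @arc_asym H y x.
have := @arc_asym G (f y) (f x).
case: (arc (f x) (f y)); case: (arc (f y) (f x)); case: (arc x y); case: (arc y x) => //=;
by do ?[move=> /(_ isT)] => //.
Qed.

Lemma card_edges_uiso (G H : ograph) : uiso G H -> #|edges G| = #|edges H|.
Proof.
(* Each arc gives two ordered adjacent pairs, distinct from those of all other arcs by asymmetry.
   The set of adjacent pairs is what [f] preserves. *)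
have half (K : ograph) : #|[set e : K * K | uadj e.1 e.2]%SET| = (#|edges K|).*2.
  pose sw (e : K * K) := (e.2, e.1).
  have sw_inj : injective sw by case=> a b [c d] [-> ->].
  have -> : [set e : K * K | uadj e.1 e.2]%SET = (edges K :|: sw @: edges K)%SET.
    apply/setP => -[a b]; rewrite !inE /uadj /=; congr (_ || _).
    apply/idP/imsetP => [ba|[[c d]]]; first by exists (b, a); rewrite ?inE.
    by rewrite inE /= => cd [-> ->].
  rewrite cardsU card_imset// addnn (_ : (_ :&: _)%SET = finset.set0) ?cards0 ?subn0//.
  apply/setP => -[a b]; rewrite !inE /=; apply/negP => /andP[ab /imsetP[[c d]]].
  by rewrite inE /= => cd [ea eb]; subst a b; move: (arc_asym cd); rewrite ab.
case=> f bf ff; apply: double_inj; rewrite -!half.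
pose ff2 (e : G * G) := (f e.1, f e.2).
rewrite -(card_imset _ (f := ff2)); last first.
  by move=> [a b] [c d] [/(bij_inj bf) -> /(bij_inj bf) ->].
apply: eq_card => -[a b]; rewrite !inE /=; have [g fK gK] := bf.
apply/imsetP/idP => [[[c d]]|ab]; first by rewrite inE /= => cd [-> ->]; rewrite ff.
by exists (g a, g b); rewrite ?inE /= -?ff /ff2 /= ?gK.
Qed.

Lemma uiso_union G G' H H' :
  uiso G G' -> uiso H H' -> uiso (disjoint_union G H) (disjoint_union G' H').
Proof.
case=> f [f' fK fK'] ff [g [g' gK gK'] gg].
exists (fun u : disjoint_union G H =>
  match u with inl x => inl (f x) | inr y => inr (g y) end : disjoint_union G' H').
  exists (fun u : disjoint_union G' H' =>
    match u with inl x => inl (f' x) | inr y => inr (g' y) end : disjoint_union G H).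
  - by case=> x /=; rewrite ?fK ?gK.
  - by case=> x /=; rewrite ?fK' ?gK'.
by case=> x [] y //=; [exact: ff | exact: gg].
Qed.

Lemma uiso_unionC G H : uiso (disjoint_union G H) (disjoint_union H G).
Proof.
exists (fun u : disjoint_union G H =>
  match u with inl x => inr x | inr y => inl y end : disjoint_union H G).
  exists (fun u : disjoint_union H G =>
    match u with inl x => inr x | inr y => inl y end : disjoint_union G H);
  by case.
by case=> x [].
Qed.

Lemma uiso_unionA G H K : uiso (disjoint_union (disjoint_union G H) K)
  (disjoint_union G (disjoint_union H K)).
Proof.
exists (fun u : disjoint_union (disjoint_union G H) K =>
  match u with inl (inl x) => inl x | inl (inr y) => inr (inl y) | inr z => inr (inr z) end
  : disjoint_union G (disjoint_union H K)).
  exists (fun u : disjoint_union G (disjoint_union H K) =>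
  match u with inl x => inl (inl x) | inr (inl y) => inl (inr y) | inr (inr z) => inr z end
   : disjoint_union (disjoint_union G H) K).
  - by case=> [[]|].
  - by case=> [|[]].
by case=> [[]|] x [[]|].
Qed.

Lemma uiso_isolated0 G : uiso (disjoint_union (isolated 0) G) G.
Proof.
exists (fun u : disjoint_union (isolated 0) G =>
  match u with inl x => match notF (ltn_ord x) with end | inr y => y end).
  exists (fun y : G => inr y : disjoint_union (isolated 0) G) => // -[[]|] //.
by case=> [[]|] x // [[]|].
Qed.

(** * Linear graphs and their decomposition into paths *)

Definition lin_arc m (p : pred nat) : rel 'I_m :=
  fun x y => (y == x.+1 :> nat) && p x.

Lemma lin_arc_asym m p (x y : 'I_m) : lin_arc p x y -> ~~ lin_arc p y x.
Proof. by rewrite /lin_arc => /andP[/eqP -> _]; lia. Qed.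

(** Up to [uiso], a cycle cut open at a missing edge has this form. The predicate lives on [nat] so
    that it can be shifted when the path is split. *)
Definition lin_graph m (p : pred nat) : ograph := OGraph (@lin_arc_asym m p).

Definition dipath n : ograph := lin_graph n.+1 predT.

Lemma lin_graph_split a b p : (a > 0)%N -> ~~ p a.-1 ->
  uiso (lin_graph (a + b) p)
       (disjoint_union (lin_graph a p) (lin_graph b (fun i => p (a + i)%N))).
Proof.
move=> a0 pa; apply: uiso_sym.
exists (fun u : disjoint_union (lin_graph a p) (lin_graph b (fun i => p (a + i)%N)) =>
  fintype.unsplit u : lin_graph (a + b) p).
  by exists (@fintype.split a b : lin_graph (a + b) p ->
    disjoint_union (lin_graph a p) (lin_graph b (fun i => p (a + i)%N)));
  [exact: fintype.unsplitK | exact: fintype.splitK].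
have cross (i : 'I_a) (j : 'I_b) :
    lin_arc p (lshift b i) (rshift a j) || lin_arc p (rshift a j) (lshift b i) = false.
  rewrite /lin_arc /=; have := ltn_ord i; have [->|] := eqVneq (nat_of_ord i) a.-1; last lia.
  by rewrite (negbTE pa) andbF /=; lia.
case=> x [] y; rewrite /uadj /=.
- by [].
- by rewrite cross.
- by rewrite orbC cross.
- by rewrite /lin_arc /= -!addnS !eqn_add2l.
Qed.

Lemma eq_lin_graph m p q : (forall i, (i.+1 < m)%N -> p i = q i) ->
  uiso (lin_graph m p) (lin_graph m q).
Proof.
move=> pq; exists id; first exact: (inv_bij (fun=> erefl)).
have E (i j : 'I_m) : lin_arc q i j = lin_arc p i j.
  rewrite /lin_arc; case: eqP => //= ji; rewrite pq//.
  by rewrite -ji.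
by move=> x y; rewrite /uadj /= !E.
Qed.

Definition path_union (s : seq nat) : ograph :=
  foldr (fun n G => disjoint_union (dipath n) G) (isolated 0) s.

Lemma path_union_cat s1 s2 :
  uiso (path_union (s1 ++ s2)) (disjoint_union (path_union s1) (path_union s2)).
Proof.
elim: s1 => [|n s IH] /=; first exact/uiso_sym/uiso_isolated0.
apply: uiso_trans (uiso_sym (uiso_unionA _ _ _)).
exact: (uiso_union (uiso_refl _) IH).
Qed.

(** Cut at any missing edge and recurse on both sides; if none is missing, the graph is a single
    path. *)
Lemma lin_graph_path_union m p : exists s, uiso (lin_graph m p) (path_union s).
Proof.
elim/ltn_ind: m p => m IH p; case: m IH => [|m] IH.
  exists [::]; exists id; first exact: (inv_bij (fun=> erefl)).
  by case.
have [[i im pi]|all_p] := pselect (exists2 i, (i < m)%N & ~~ p i).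
  have [s1 h1] := IH i.+1 im p.
  have lt2 : (m - i < m.+1)%N by lia.
  have [s2 h2] := IH _ lt2 (fun j => p (i.+1 + j)%N).
  exists (s1 ++ s2); apply: uiso_trans (uiso_sym (path_union_cat _ _)).
  apply: uiso_trans (uiso_union h1 h2).
  have -> : m.+1 = (i.+1 + (m - i))%N by lia.
  exact: lin_graph_split.
exists [:: m] => /=; apply: uiso_trans (uiso_unionC _ _).
apply: uiso_trans (uiso_sym (uiso_isolated0 _)).
apply: eq_lin_graph => i im /=; apply: contrapT => /negP pi.
by apply: all_p; exists i.
Qed.

Lemma dipath_Q n : uiso (dipath n.*2) (Q n).
Proof.
exists id; first exact: (inv_bij (fun=> erefl)).
move=> x y; rewrite /uadj /= /Q_arc /lin_arc /=; lia.
Qed.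

Lemma path_union_even s : uiso (path_union (map double s)) (Q_union s).
Proof.
elim: s => [|n s IH] /=; first exact: uiso_refl.
exact: (uiso_union (dipath_Q n) IH).
Qed.

Lemma Q0_isolated : uiso (Q 0) (isolated 1).
Proof.
exists id; first exact: (inv_bij (fun=> erefl)).
by move=> x y; rewrite (ord1 x) (ord1 y).
Qed.

Lemma uiso_isolatedD m n :
  uiso (disjoint_union (isolated m) (isolated n)) (isolated (m + n)).
Proof.
exists (fun u : disjoint_union (isolated m) (isolated n) => fintype.unsplit u : isolated (m + n)).
  by exists (@fintype.split m n : isolated (m + n) -> disjoint_union (isolated m) (isolated n));
  [exact: fintype.unsplitK | exact: fintype.splitK].
by case=> x [].
Qed.

(** [Q 0] is a single vertex. One-vertex components have to join the isolated vertices because the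
    hypotheses on [alpha] concern positive lengths only. *)
Lemma Q_union_filter s : exists m,
  uiso (Q_union s) (disjoint_union (Q_union [seq n <- s | (0 < n)%N]) (isolated m)).
Proof.
elim: s => [|[|n] s [m IH]] /=.
- exists 0%N; exact/uiso_sym/uiso_isolated0.
- exists (m + 1)%N; apply: uiso_trans (uiso_union Q0_isolated IH) _.
  apply: uiso_trans (uiso_unionC _ _) _; apply: uiso_trans (uiso_unionA _ _ _) _.
  exact: uiso_union (uiso_refl _) (uiso_isolatedD _ _).
- exists m; apply: uiso_trans (uiso_union (uiso_refl _) IH) _.
  exact/uiso_sym/uiso_unionA.
Qed.

Lemma dipath_odd_reversal n : odd n -> reversal true (dipath n) (dipath n).
Proof.
move=> on; exists (edges (dipath n)); split => //.
  rewrite (_ : #|edges _| = n)// -[RHS]card_ord.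
  (* Arcs are indexed by their tails, so reversing all of them has the parity of [n]. *)
  pose e (i : 'I_n) : dipath n * dipath n := (widen_ord (leqnSn n) i, lift ord0 i).
  rewrite -(card_imset _ (f := e)); last by move=> i j [] /val_inj.
  apply: eq_card => -[x y]; rewrite !inE /= /lin_arc andbT.
  apply/eqP/imsetP => [yx|[i _ [-> ->]]]//=.
  have xn : (x < n)%N by have := ltn_ord y; rewrite yx.
  by exists (Ordinal xn) => //; congr pair; apply: val_inj.
exists (@rev_ord _ : dipath n -> dipath n); first exact: (inv_bij (@rev_ordK _)).
move=> x y; rewrite /= /rev_arc !inE /= /lin_arc /=.
have := ltn_ord x; have := ltn_ord y; lia.
Qed.

(** * Cutting a cycle at a missing edge *)

Section Cycle.
Variables (C : ograph).

Lemma val_iter_ordS l k (i : 'I_l) : val (iter k (@ordS l) i) = ((i + k) %% l)%N.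
Proof.
elim: k => [|k IH] /=; first by rewrite addn0 modn_small.
by rewrite [X in (X.+1 %% _)%N]IH -addn1 modnDml addn1 addnS.
Qed.

(** Renumbers the cycle so that the edge at [k] becomes the one from the last index back to 0. The
    shift is by [k.+1] since [l.-1 + k.+1] is [k] modulo [l]. *)
Lemma cycle_rotation l (f : 'I_l -> C) (k : 'I_l) : bijective f ->
  (forall i j, uadj (f i) (f j) = (j == ordS i) || (i == ordS j)) ->
  exists2 g : 'I_l -> C, bijective g &
    (forall i j, uadj (g i) (g j) = (j == ordS i) || (i == ordS j)) /\
    forall i : 'I_l, i = l.-1 :> nat -> g i = f k /\ g (ordS i) = f (ordS k).
Proof.
move=> bf ff; exists (f \o iter k.+1 (@ordS l)).
  apply: bij_comp => //; elim: k.+1 => [|m IH] /=; first exact: (inv_bij (fun=> erefl)).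
  exact: (bij_comp (@ordS_bij l) IH).
have inj : injective (iter k.+1 (@ordS l)).
  by elim: k.+1 => [|m IH] //= x y /ordS_inj/IH.
have E x : ordS (iter k.+1 (@ordS l) x) = iter k.+1 (@ordS l) (ordS x).
  by rewrite -iterS -iterSr.
split=> [i j|i il].
  by have := ff (iter k.+1 (@ordS l) i) (iter k.+1 (@ordS l) j); rewrite !E !(inj_eq inj).
have ik : iter k.+1 (@ordS l) i = k.
  apply: val_inj; rewrite val_iter_ordS il.
  have kl := ltn_ord k; have -> : (l.-1 + k.+1 = k + l)%N by lia.
  by rewrite modnDr modn_small.
by rewrite -[in f k]ik -[in f (ordS k)]ik E.
Qed.

Lemma spanning_cycle_lin_graph (F : {set C * C}) :
  oriented_cycle C -> (F \proper edges C)%SET ->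
  exists p, uiso (spanning F) (lin_graph #|C| p).
Proof.
move=> [+ [+ + +]] /fintype.properP [FE [[u v] uvE uvF]].
move: #|C| => l l3 f bf ff.
(* The missing arc may run either way around the cycle. The opposite arc is absent from [C] by
   asymmetry, so the undirected edge is missing too. *)
have [k fk] : exists k, ~~ uadj (f k : spanning F) (f (ordS k)).
  have [f' fK f'K] := bf; move: uvE; rewrite inE /= => uv.
  have nadj : ~~ uadj (u : spanning F) v.
    rewrite /uadj /= /span_arc (negbTE uvF) andbF /=; apply/negP => /andP[vu _].
    by move: (arc_asym uv); rewrite vu.
  have := ff (f' u) (f' v); rewrite !f'K uv /= => /esym/orP[/eqP e|/eqP e].
    by exists (f' u); rewrite -e !f'K.
  by exists (f' v); rewrite -e !f'K /uadj orbC.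
have [g bg [gg gk]] := cycle_rotation k bf ff.
(* [p] records which cycle edges survive in [F]; the quantifier over ordinals makes it a predicate
   on [nat]. *)
apply: (@ex_intro _ _ (fun n => [exists i : 'I_l, (i == n :> nat) &&
  uadj (g i : spanning F) (g (ordS i))])); apply: uiso_sym.
set p := (X in lin_graph _ X).
have pE (i : 'I_l) : p i = uadj (g i : spanning F) (g (ordS i)).
  apply/existsP/idP => [[j /andP[/eqP/val_inj -> //]]|h].
  by exists i; rewrite eqxx.
have usym (G : ograph) (x y : G) : uadj x y = uadj y x by rewrite /uadj orbC.
have sub (x y : C) : uadj (x : spanning F) y -> uadj x y.
  by rewrite /uadj /= /span_arc => /orP[] /andP[-> _]; rewrite ?orbT.
have ordSE (i : 'I_l) : ordS i = (if i.+1 == l then 0%N else i.+1) :> nat.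
  rewrite /=; have := ltn_ord i; case: eqP => [->|ne lt]; first by rewrite modnn.
  by rewrite modn_small//; lia.
(* At the last index both sides are false: the left by the choice of [k], the right because 0 and
   [l.-1] are not consecutive when [l] is at least 3. *)
have adj (i : 'I_l) : uadj (g i : spanning F) (g (ordS i)) =
    uadj (i : lin_graph l p) (ordS i).
  rewrite [RHS]/uadj /= /lin_arc pE !ordSE; have [il|_] := eqVneq i.+1 l.
    have [|-> ->] := gk i; first exact: (congr1 predn il).
    rewrite (negbTE fk); lia.
  by rewrite eqxx /=; case: uadj => //=; lia.
exists g => // i j.
have [->|nij] := eqVneq j (ordS i); first exact: adj.
have [->|nji] := eqVneq i (ordS j); first by rewrite usym adj usym.
transitivity false.
  by apply/negbTE/negP => /sub; rewrite gg (negbTE nij) (negbTE nji).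
apply/esym/negbTE/negP; rewrite /uadj /= /lin_arc => /orP[]/andP[/eqP e _].
  by move/negP: nij; apply; apply/eqP/ord_inj; rewrite ordSE -e ltn_eqF.
by move/negP: nji; apply; apply/eqP/ord_inj; rewrite ordSE -e ltn_eqF.
Qed.

Lemma oriented_cycle_D : oriented_cycle C -> ~~ odd #|C| -> uiso C (D #|C|./2).
Proof.
move=> [C3 [f bf ff]] /even_halfK.
move: #|C|./2 C3 f bf ff => n + + + + Cn; rewrite -Cn => n3 f bf ff.
apply: uiso_sym; exists f => // i j; rewrite /uadj ff /= /D_arc.
rewrite !(leqNgt n).
by case: (j == ordS i); case: (i == ordS j); case: (i < n)%N; case: (j < n)%N.
Qed.

End Cycle.

(** * Densities in an antisymmetric kernel *)

Section Antisymmetric.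
Context (R : realType).
Local Notation T := (measurableTypeR R).
Local Notation P := (uniform_prob (@ltr01 R)).
Variable V : T * T -> R.
Hypothesis bV : bounded_mfun V.

Lemma iid_cube (G : finType) :
  iid (cube_measure R #|G|) (fun (v : G) x => tnth x (enum_rank v)).
Proof. exact: (iid_reindex (@enum_rank_bij G) (iid_tnth R #|G|)). Qed.

Lemma arc_prod_iso (G H : ograph) (f : H -> G) (y : G -> T) : bijective f ->
  (forall u v, arc (f u) (f v) = arc u v) ->
  arc_prod V (fun v => y (f v)) = arc_prod V y.
Proof.
move=> bf ff; rewrite /arc_prod [RHS](reindex (fun e : H * H => (f e.1, f e.2))) /=.
  by apply: eq_bigl => e; rewrite !inE /= ff.
have [g fK gK] := bf; apply: onW_bij.
by exists (fun e => (g e.1, g e.2)) => -[a b] /=; rewrite ?fK ?gK.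
Qed.

Lemma density_iso (G H : ograph) : isomorphic H G -> density H V = density G V.
Proof.
case=> f bf ff; rewrite (density_iid bV (iid_cube G)).
rewrite (density_iid bV (iid_reindex bf (iid_cube G))).
by apply: eq_Rintegral => x _; rewrite -(arc_prod_iso _ bf ff).
Qed.

Lemma arc_prodE (G : ograph) (x : G -> T) :
  arc_prod V x = \prod_(a : G) \prod_(b | arc a b) V (x a, x b).
Proof. by rewrite pair_big_dep; apply: eq_bigl => e; rewrite !inE. Qed.

Lemma arc_prod_union (G H : ograph) (x : disjoint_union G H -> T) :
  arc_prod V x = arc_prod V (fun v : G => x (inl v)) * arc_prod V (fun v : H => x (inr v)).
Proof.
rewrite !arc_prodE big_sumType /=; congr (_ * _); apply: eq_bigr => a _.
  by rewrite big_sumType /= [X in _ * X]big_pred0 ?mulr1.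
by rewrite big_sumType /= [X in X * _]big_pred0 ?mul1r.
Qed.

Lemma density_union (G H : ograph) :
  density (disjoint_union G H) V = density G V * density H V.
Proof.
rewrite (@density_iid _ (disjoint_union G H) _ _ _ _ _ bV (iid_sum (iid_cube G) (iid_cube H))).
rewrite (density_iid bV (iid_cube G)) (density_iid bV (iid_cube H)).
pose FG x := arc_prod V (fun v : G => tnth x (enum_rank v)).
pose FH x := arc_prod V (fun v : H => tnth x (enum_rank v)).
have bG : bounded_mfun FG by apply: bounded_mfun_arc_prod => // v; exact: measurable_tnth.
have bH : bounded_mfun FH by apply: bounded_mfun_arc_prod => // v; exact: measurable_tnth.
transitivity (\int[prod_prob (cube_measure R #|G|) (cube_measure R #|H|)]_w (FG w.1 * FH w.2)).
  by apply: eq_Rintegral => w _; rewrite arc_prod_union.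
rewrite Rintegral_prod12; last first.
  apply: bounded_mfunM.
    exact: (bounded_mfun_comp bG measurable_fst).
  exact: (bounded_mfun_comp bH measurable_snd).
rewrite /=; under eq_Rintegral do rewrite RintegralZl ?(bounded_mfun_integrable _ bH)//.
by rewrite RintegralZr ?(bounded_mfun_integrable _ bG).
Qed.

Lemma density_no_edges (G : ograph) : edges G = finset.set0 -> density G V = 1.
Proof.
move=> G0; rewrite (density_iid bV (iid_cube G)).
under eq_Rintegral do rewrite /arc_prod G0 big_set0.
by rewrite Rintegral_cst// [fine _](congr1 fine (probability_setT _)) mulr1.
Qed.

Lemma density_isolated m : density (isolated m) V = 1.
Proof. by apply: density_no_edges; apply/setP => e; rewrite !inE. Qed.

Hypothesis antiV : forall x y, V (x, y) = - V (y, x).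

Lemma density_reverse (G : ograph) (X : {set G * G}) : X \subset edges G ->
  density (reverse X) V = (-1) ^+ odd #|X| * density G V.
Proof.
move=> XE; rewrite (density_iid bV (iid_cube G)).
rewrite (@density_iid _ (reverse X) _ _ _ _ _ bV (iid_cube G)).
rewrite -RintegralZl//; last first.
  apply: bounded_mfun_integrable; apply: bounded_mfun_arc_prod => // v.
  exact: measurable_tnth.
apply: eq_Rintegral => x _.
move: (fun v => _) => y; rewrite /arc_prod.
(* Kept and swapped arcs are disjoint by [arc_asym], so the product splits and each swapped factor
   yields one sign. *)
have -> : edges (reverse X) = ((edges G :\: X) :|: (fun e => (e.2, e.1)) @: X)%SET.
  apply/setP => -[a b]; rewrite !inE /= /rev_arc andbC; congr (_ || _).
  apply/andP/imsetP => [[_ ba]|[[c d] cd [-> ->]]]; first by exists (b, a).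
  by split=> //; move/fintype.subsetP: XE => /(_ _ cd); rewrite inE.
rewrite [LHS](eq_bigl [predU (mem (edges G :\: X)%SET) &
    mem ((fun e => (e.2, e.1)) @: X)%SET]); last first.
  by move=> e; rewrite !inE.
rewrite bigU /=; last first.
  apply/pred0P => -[a b] /=; apply/negP => /andP[]; rewrite !inE /= => /andP[_ ab].
  case/imsetP => -[c d] /(fintype.subsetP XE); rewrite inE /= => cd [ea eb]; subst.
  by move: (arc_asym cd); rewrite ab.
rewrite big_imset /=; last by move=> [a b] [c d] _ _ [-> ->].
rewrite [in RHS](bigID (mem X)) /=.
rewrite [X in _ * X = _](eq_bigr (fun e => - V (y e.1, y e.2))); last by move=> e _; rewrite antiV.
rewrite prodrN signr_odd mulrCA; congr (_ * _).
rewrite mulrC; congr (_ * _).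
  by apply: eq_bigl => e; rewrite andbC; case: (boolP (e \in X)) => // /(fintype.subsetP XE) ->.
by apply: eq_bigl => e; rewrite !inE andbC.
Qed.

Lemma density_reversal b (G H : ograph) :
  reversal b G H -> density H V = (-1) ^+ b * density G V.
Proof. by case=> X [XE <- /density_iso ->]; exact: density_reverse. Qed.

Lemma density_reversal_isolated b (G H : ograph) :
  reversal_isolated b G H -> density H V = (-1) ^+ b * density G V.
Proof.
case=> X [m [XE <- /density_iso ->]].
by rewrite density_union density_isolated mulr1; exact: density_reverse.
Qed.

(** The sign relating the two densities is unknown, but it does not affect vanishing. *)
Lemma density_uiso_eq0 (G H : ograph) : uiso H G -> density G V = 0 -> density H V = 0.
Proof. by case/uiso_reversal => b /density_reversal -> ->; rewrite mulr0. Qed.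

Lemma density_dipath_odd n : odd n -> density (dipath n) V = 0.
Proof. by move/dipath_odd_reversal/density_reversal; rewrite expr1 mulN1r; lra. Qed.

Lemma density_path_union_odd s : has odd s -> density (path_union s) V = 0.
Proof.
elim: s => //= n s IH /orP[/density_dipath_odd|/IH] h; rewrite density_union h.
  by rewrite mul0r.
by rewrite mulr0.
Qed.

End Antisymmetric.

(** * Densities of Q and D as integrals over walks *)

Section Walks.
Context (R : realType).
Local Notation T := (measurableTypeR R).
Local Notation P := (uniform_prob (@ltr01 R)).
Variable V : T * T -> R.
Hypothesis bV : bounded_mfun V.

(** Given [x], the two branches are independent with the same law. Here [x] will be the centre of
    [Q n], or the pair of source and sink of [D n]. *)
Lemma Rintegral_twin d1 d2 (T1 : measurableType d1) (T2 : measurableType d2)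
    (P1 : probability T1 R) (P2 : probability T2 R) (A : T1 * T2 -> R) :
  bounded_mfun A ->
  \int[prod_prob P1 (prod_prob P2 P2)]_w (A (w.1, w.2.1) * A (w.1, w.2.2)) =
  \int[P1]_x (\int[P2]_y A (x, y)) ^+ 2.
Proof.
move=> bA.
have bA1 : bounded_mfun (fun w : T1 * (T2 * T2) => A (w.1, w.2.1)).
  apply: (bounded_mfun_comp (g := fun w : T1 * (T2 * T2) => (w.1, w.2.1)) bA).
  by apply: measurable_fun_pair => //; exact: measurableT_comp.
have bA2 : bounded_mfun (fun w : T1 * (T2 * T2) => A (w.1, w.2.2)).
  apply: (bounded_mfun_comp (g := fun w : T1 * (T2 * T2) => (w.1, w.2.2)) bA).
  by apply: measurable_fun_pair => //; exact: measurableT_comp.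
rewrite (@Rintegral_prod12 _ _ _ _ _ P1 (prod_prob P2 P2)); last exact: bounded_mfunM.
apply: eq_Rintegral => x _ /=.
have bAx : bounded_mfun (fun y => A (x, y)) by exact: bounded_mfun_slice1.
have bf : bounded_mfun (fun w : T2 * T2 => A (x, w.1) * A (x, w.2)).
  by apply: bounded_mfunM; apply: (bounded_mfun_comp bAx).
rewrite (Rintegral_prod12 P2 P2 bf) /=.
under eq_Rintegral do rewrite RintegralZl ?(bounded_mfun_integrable _ bAx)//.
by rewrite RintegralZr ?(bounded_mfun_integrable _ bAx).
Qed.

(* The points of the walk starting at [p.1]; the value for [i > n] is junk. *)
Definition pt n (p : T * n.-tuple T) (i : nat) : T := nth p.1 (p.1 :: p.2) i.

Lemma measurable_pt n i : measurable_fun setT (fun p : T * n.-tuple T => pt p i).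
Proof.
case: i => [|i]; first exact: measurable_fst.
have [lin|nli] := ltnP i n; last first.
  rewrite (_ : (fun p => _) = fst); first exact: measurable_fst.
  by apply/funext => p; rewrite /pt /= nth_default// size_tuple.
rewrite (_ : (fun p => _) = (fun t => tnth t (Ordinal lin)) \o snd).
  by apply: measurableT_comp => //; exact: measurable_tnth.
by apply/funext => p; rewrite /pt /= (tnth_nth p.1).
Qed.

Definition walk n (p : T * n.-tuple T) : R := \prod_(i < n) V (pt p i, pt p i.+1).

Lemma bounded_mfun_pt d (Om : measurableType d) (f g : Om -> T) :
  measurable_fun setT f -> measurable_fun setT g ->
  bounded_mfun (fun w => V (f w, g w)).
Proof.
move=> mf mg; apply: (bounded_mfun_comp (g := fun w => (f w, g w)) bV).
exact: measurable_fun_pair.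
Qed.

Lemma bounded_mfun_walk n : bounded_mfun (@walk n).
Proof.
by apply: bounded_mfun_prod => i; apply: bounded_mfun_pt; exact: measurable_pt.
Qed.

Definition kernel_op (f : T -> R) : T -> R := fun x => \int[P]_y (V (x, y) * f y).

Lemma bounded_mfun_kernel_op f : bounded_mfun f -> bounded_mfun (kernel_op f).
Proof.
move=> bf; apply: (@bounded_mfun_int2 _ _ _ _ _ P P (fun p => V p * f p.2)).
by apply: bounded_mfunM => //; exact: (bounded_mfun_comp bf).
Qed.

Lemma bounded_mfun_iter_op n f : bounded_mfun f -> bounded_mfun (iter n kernel_op f).
Proof. by move=> bf; elim: n => //= n; exact: bounded_mfun_kernel_op. Qed.

(** The function [f] weights the end point: it is 1 for an arm of [Q n], and the arc into a fixed
    sink for a half of [D n]. The induction peels off the first step of the walk. *)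
Lemma Rintegral_walk n f x : bounded_mfun f ->
  \int[cube_measure R n]_t (walk (x, t) * f (pt (x, t) n)) = iter n kernel_op f x.
Proof.
move=> bf; elim: n x => [|n IH] x.
  under eq_Rintegral do rewrite /walk big_ord0 mul1r /pt /=.
  by rewrite Rintegral_cst// [fine _](congr1 fine (probability_setT _)) mulr1.
have bw m : bounded_mfun (fun p : T * m.-tuple T => walk p * f (pt p m)).
  apply: bounded_mfunM; first exact: bounded_mfun_walk.
  exact: (bounded_mfun_comp bf (measurable_pt _)).
rewrite (@Rintegral_pushforward _ _ _ _ _ (prod_prob P (cube_measure R n)) _
  (@cons_pair R n) _ (@measurable_cons_pair R n))//; last first.
  exact: (bounded_mfun_slice1 x (bw n.+1)).
have E (y : T) (t : n.-tuple T) :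
    walk (x, cons_pair (y, t)) * f (pt (x, cons_pair (y, t)) n.+1) =
    V (x, y) * (walk (y, t) * f (pt (y, t) n)).
  (* The two sides use different defaults for [nth], so the index must be in range. *)
  have ptS i : (i <= n)%N -> pt (x, cons_pair (y, t)) i.+1 = pt (y, t) i.
    by move=> lin; apply: set_nth_default; rewrite /= size_tuple.
  rewrite /walk big_ord_recl /= ptS// -!mulrA ptS//; congr (_ * (_ * _)).
  by apply: eq_bigr => i _; rewrite !ptS// ltnW.
transitivity (\int[prod_prob P (cube_measure R n)]_w (V (x, w.1) * (walk w * f (pt w n)))).
  by apply: eq_Rintegral => -[y t] _; rewrite E.
rewrite Rintegral_prod12; last first.
  apply: bounded_mfunM; last exact: bw.
  by apply: (@bounded_mfun_pt _ _ (fun=> x) fst); [exact: measurable_cst | exact: measurable_fst].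
rewrite [RHS]/kernel_op; apply: eq_Rintegral => y _ /=.
by rewrite RintegralZl// ?IH//; apply/bounded_mfun_integrable/(bounded_mfun_slice1 y (bw n)).
Qed.

Lemma arc_prod_param (G : ograph) (I : finType) (e : I -> G * G) (x : G -> T) :
  injective e -> (forall p, (p \in edges G) = (p \in codom e)) ->
  arc_prod V x = \prod_i V (x (e i).1, x (e i).2).
Proof.
move=> inj_e eE; rewrite /arc_prod -(big_imset (fun p => V (x p.1, x p.2)) (h := e) (A := I))/=.
  apply: eq_bigl => p; rewrite eE.
  by apply/codomP/imsetP => [[i ->]|[i _ ->]]; exists i.
by move=> i j _ _ /inj_e.
Qed.


Section Q.
Variable n : nat.

(** Centre, left arm and right arm, both arms read outwards, in the shape of the sample space of
    [Rintegral_twin]. *)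
Let h (u : 'I_1 + ('I_n + 'I_n)) : Q n :=
  match u with
  | inl _ => inord n
  | inr (inl j) => inord (n - j.+1)
  | inr (inr j) => inord (n + j.+1)
  end.

Let vh u : nat_of_ord (h u : 'I_n.*2.+1) = match u with
  | inl _ => n
  | inr (inl j) => (n - j.+1)%N
  | inr (inr j) => (n + j.+1)%N
  end.
Proof. by case: u => [|[]] j; rewrite /h inordK//; have := ltn_ord j; lia. Qed.

Let h_bij : bijective h.
Proof.
apply: inj_card_bij; last by rewrite !card_sum !card_ord; lia.
move=> u v /(congr1 (fun i : 'I_n.*2.+1 => nat_of_ord i)); rewrite !vh.
case: u => [i|[i|i]]; case: v => [j|[j|j]]; have := ltn_ord i; have := ltn_ord j => hi hj uv;
  try lia.
- by rewrite (ord1 i) (ord1 j).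
- by congr (inr (inl _)); apply: val_inj => /=; lia.
- by congr (inr (inr _)); apply: val_inj => /=; lia.
Qed.

Lemma density_Q : density (Q n) V = \int[P]_x (iter n kernel_op (fun=> 1) x) ^+ 2.
Proof.
have [g hK gK] := h_bij.
have bg : bijective g by exists h.
rewrite (@density_iid _ (Q n) _ _ _ _ _ bV
  (iid_reindex bg (iid_sum (iid_id R) (iid_sum (iid_tnth R n) (iid_tnth R n))))).
under [RHS]eq_Rintegral => x _.
  rewrite -Rintegral_walk; last exact: bounded_mfun_cst.
  under eq_Rintegral do rewrite mulr1.
  over.
rewrite -(Rintegral_twin _ _ (bounded_mfun_walk n)).
apply: eq_Rintegral => -[x [y z]] _ /=.
set X := (fun v : Q n => _).
have Xy i : (i <= n)%N -> X (inord (n - i)) = pt (x, y) i.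
  case: i => [|i] lin; rewrite /X.
    by rewrite (_ : inord _ = h (inl ord0)) ?hK// subn0.
  rewrite (_ : inord _ = h (inr (inl (Ordinal lin)))) ?hK//.
  by rewrite (tnth_nth x).
have Xz i : (i <= n)%N -> X (inord (n + i)) = pt (x, z) i.
  case: i => [|i] lin; rewrite /X.
    by rewrite (_ : inord _ = h (inl ord0)) ?hK// addn0.
  rewrite (_ : inord _ = h (inr (inr (Ordinal lin)))) ?hK//.
  by rewrite (tnth_nth x).
(* Since all arcs point away from the centre, each arm is traversed as a walk from it. *)
pose e (u : 'I_n + 'I_n) : Q n * Q n := match u with
  | inl i => (inord (n - i), inord (n - i.+1))
  | inr i => (inord (n + i), inord (n + i.+1)) end.
rewrite (@arc_prod_param _ _ e).
- rewrite big_sumType /=; congr (_ * _); apply: eq_bigr => i _.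
    by rewrite !Xy// ltnW.
  by rewrite !Xz// ltnW.
- move=> u v /(congr1 (fun p : 'I_n.*2.+1 * 'I_n.*2.+1 => (nat_of_ord p.1, nat_of_ord p.2))).
  case: u => i; case: v => j; rewrite /= !inordK; try lia;
    have := ltn_ord i; have := ltn_ord j => hi hj; try lia; case=> e1 e2; try lia.
    by congr inl; apply: val_inj => /=; lia.
  by congr inr; apply: val_inj => /=; lia.
- move=> [a b]; rewrite inE /=; apply/idP/codomP => [|[[i|i] [-> ->]]]; last 2 first.
  + by rewrite /Q_arc !inordK; have := ltn_ord i; lia.
  + by rewrite /Q_arc !inordK; have := ltn_ord i; lia.
  rewrite /Q_arc; have := ltn_ord a; have := ltn_ord b => bn an /orP[]/andP[h1 /eqP h2].
    have lt : (a - n < n)%N by lia.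
    exists (inr (Ordinal lt)) => /=; congr pair; apply: ord_inj; rewrite inordK; lia.
  have lt : (n - a < n)%N by lia.
  exists (inl (Ordinal lt)) => /=; congr pair; apply: ord_inj; rewrite inordK; lia.
Qed.

Lemma density_Q_ge0 : 0 <= density (Q n) V.
Proof. by rewrite density_Q; apply: Rintegral_ge0 => x _; apply: sqr_ge0. Qed.

End Q.

Lemma density_Q_union_ge0 s : 0 <= density (Q_union s) V.
Proof.
elim: s => [|n s IH] /=; first by rewrite density_isolated.
by rewrite density_union// mulr_ge0// density_Q_ge0.
Qed.

End Walks.

(** * The density of D as a squared Hilbert-Schmidt norm *)

Section CycleKernel.
Context (R : realType).
Local Notation T := (measurableTypeR R).
Local Notation P := (uniform_prob (@ltr01 R)).
Variable V : T * T -> R.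
Hypothesis bV : bounded_mfun V.
Local Notation op := (kernel_op V).

Section D.
Variable m : nat.
(** For [m = 0] the two paths from source to sink would be the same arc. *)
Hypothesis m_gt0 : (0 < m)%N.

Let vtx (i : nat) : D m.+1 := @inord m.*2.+1 i.

Let vtxK i : (i < m.+1.*2)%N -> nat_of_ord (vtx i : 'I_m.+1.*2) = i.
Proof. exact: inordK. Qed.

(** Source and sink, then the inner vertices of both paths; the second path is numbered backwards
    around the cycle from the source. *)
Let h (u : ('I_1 + 'I_1) + ('I_m + 'I_m)) : D m.+1 :=
  match u with
  | inl (inl _) => vtx 0
  | inl (inr _) => vtx m.+1
  | inr (inl j) => vtx j.+1
  | inr (inr j) => vtx (m.+1.*2 - j.+1)
  end.

Let vh u : nat_of_ord (h u : 'I_m.+1.*2) = match u with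
  | inl (inl _) => 0
  | inl (inr _) => m.+1
  | inr (inl j) => j.+1
  | inr (inr j) => (m.+1.*2 - j.+1)%N
  end.
Proof. by case: u => [[]|[]] j; rewrite /h vtxK//; have := ltn_ord j; lia. Qed.

Let h_bij : bijective h.
Proof.
apply: inj_card_bij; last by rewrite !card_sum !card_ord; lia.
move=> u v /(congr1 (fun i : 'I_m.+1.*2 => nat_of_ord i)); rewrite !vh.
case: u => [[i|i]|[i|i]]; case: v => [[j|j]|[j|j]];
  have := ltn_ord i; have := ltn_ord j => hi hj uv;
  try lia.
- by rewrite (ord1 i) (ord1 j).
- by rewrite (ord1 i) (ord1 j).
- by congr (inr (inl _)); apply: val_inj => /=; lia.
- by congr (inr (inr _)); apply: val_inj => /=; lia.
Qed.

(** For fixed source [s.1] and sink [s.2] each path contributes the kernel of the power [m.+1] of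
    the operator: [m] inner steps applied to the last arc, a function of its tail. *)
Lemma density_D : density (D m.+1) V =
  \int[prod_prob P P]_s (iter m op (fun u => V (u, s.2)) s.1) ^+ 2.
Proof.
have [g hK gK] := h_bij.
have bg : bijective g by exists h.
rewrite (@density_iid _ (D m.+1) _ _ _ _ _ bV
  (iid_reindex bg (iid_sum (iid_sum (iid_id R) (iid_id R))
                           (iid_sum (iid_tnth R m) (iid_tnth R m))))).
pose A (p : (T * T) * m.-tuple T) := walk V (p.1.1, p.2) * V (pt (p.1.1, p.2) m, p.1.2).
have bA : bounded_mfun A.
  have m1 : measurable_fun setT (fun p : (T * T) * m.-tuple T => (p.1.1, p.2)).
    by apply: measurable_fun_pair => //; exact: measurableT_comp.
  apply: bounded_mfunM; first exact: (bounded_mfun_comp (bounded_mfun_walk bV m) m1).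
  apply: (bounded_mfun_pt bV); last exact: measurableT_comp.
  exact: (measurableT_comp (measurable_pt _) m1).
under [RHS]eq_Rintegral => s _.
  rewrite -(Rintegral_walk bV); last exact: bounded_mfun_slice2.
  over.
rewrite -(Rintegral_twin _ _ bA).
apply: eq_Rintegral => -[[x w] [y z]] _ /=.
set X := (fun v : D m.+1 => _).
(* The second directed path from the source [0] to the sink [m.+1]. *)
pose vtx2 i := vtx (if i == 0 then 0 else m.+1.*2 - i)%N.
have X0 : X (vtx 0) = x by rewrite /X (_ : vtx 0 = h (inl (inl ord0))) ?hK.
have Xw : X (vtx m.+1) = w by rewrite /X (_ : vtx _ = h (inl (inr ord0))) ?hK.
have Xw2 : X (vtx2 m.+1) = w by rewrite /vtx2 /= -Xw; congr (X (vtx _)); lia.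
have Xy i : (i <= m)%N -> X (vtx i) = pt (x, y) i.
  case: i => [|i] lin; first by rewrite X0.
  rewrite /X (_ : vtx _ = h (inr (inl (Ordinal lin)))) ?hK//.
  by rewrite (tnth_nth x).
have Xz i : (i <= m)%N -> X (vtx2 i) = pt (x, z) i.
  case: i => [|i] lin; first by rewrite /vtx2 eqxx X0.
  rewrite /X (_ : vtx2 _ = h (inr (inr (Ordinal lin)))) ?hK//.
  by rewrite (tnth_nth x).
pose e (u : 'I_m.+1 + 'I_m.+1) : D m.+1 * D m.+1 := match u with
  | inl i => (vtx i, vtx i.+1)
  | inr i => (vtx2 i, vtx2 i.+1) end.
have v2E i : (i <= m.+1)%N ->
    nat_of_ord (vtx2 i : 'I_m.+1.*2) = (if i == 0 then 0 else m.+1.*2 - i)%N.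
  by move=> im; rewrite /vtx2 vtxK//; case: eqP; lia.
have v1E i : (i <= m.+1)%N -> nat_of_ord (vtx i : 'I_m.+1.*2) = i.
  by move=> im; rewrite vtxK//; lia.
have ordSE (u : 'I_m.+1.*2) : nat_of_ord (ordS u) = (if u.+1 == m.+1.*2 then 0 else u.+1)%N.
  rewrite /=; have := ltn_ord u; case: eqP => [->|ne lt]; first by rewrite modnn.
  by rewrite modn_small//; lia.
have D_arcE (a b : 'I_m.+1.*2) : D_arc a b =
  (nat_of_ord b == (if a.+1 == m.+1.*2 then 0 else a.+1)%N) && (a < m.+1)%N ||
  (nat_of_ord a == (if b.+1 == m.+1.*2 then 0 else b.+1)%N) && (m.+1 <= b)%N.
  by rewrite /D_arc -!ordSE.
rewrite (@arc_prod_param _ _ _ _ e).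
- rewrite big_sumType /= !big_ord_recr /= Xw Xw2 Xy// Xz// /A /walk /=.
  congr (_ * _ * (_ * _)); apply: eq_bigr => i _.
    by rewrite !Xy// ltnW.
  by rewrite !Xz// ltnW.
- move=> u v /(congr1 (fun p : 'I_m.+1.*2 * 'I_m.+1.*2 => (nat_of_ord p.1, nat_of_ord p.2))).
  case: u => i; case: v => j; have := ltn_ord i; have := ltn_ord j => hi hj;
    rewrite [e _]/= [e _]/= ?(v1E _ (ltnW hi)) ?(v1E _ hi) ?(v2E _ (ltnW hi)) ?(v2E _ hi);
    rewrite ?(v1E _ (ltnW hj)) ?(v1E _ hj) ?(v2E _ (ltnW hj)) ?(v2E _ hj) => -[].
  + by move=> ij _; congr inl; apply: val_inj.
  + by do ?case: eqP; lia.
  + by do ?case: eqP; lia.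
  + by do ?case: eqP; move=> *; congr inr; apply: val_inj => /=; lia.
- move=> [a b]; rewrite inE /= D_arcE; apply/idP/codomP => [|[[i|i] [-> ->]]]; last 2 first.
  + by have hi := ltn_ord i; rewrite (v1E _ (ltnW hi)) (v1E _ hi); do ?case: eqP; lia.
  + by have hi := ltn_ord i; rewrite (v2E _ (ltnW hi)) (v2E _ hi); do ?case: eqP; lia.
  have ha := ltn_ord a; have hb := ltn_ord b.
  move=> /orP[]/andP[/eqP h1 h2].
    exists (inl (Ordinal h2)) => /=; congr pair; apply: ord_inj; rewrite v1E//.
      exact: ltnW.
    by rewrite h1; case: eqP; lia.
  have lt : (m.+1.*2 - b.+1 < m.+1)%N by lia.
  exists (inr (Ordinal lt)) => /=; congr pair; apply: ord_inj; rewrite v2E//; try lia.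
    by rewrite h1; do ?case: eqP; lia.
  by rewrite /=; lia.
Qed.

Lemma density_D_ge0 : 0 <= density (D m.+1) V.
Proof. by rewrite density_D; apply: Rintegral_ge0 => x _; apply: sqr_ge0. Qed.

End D.
End CycleKernel.

(** * Antisymmetric kernel operators *)

Section DensityMeasure.
Context d (T : measurableType d) (R : realType) (P : probability T R).
Variable f : T -> R.
Hypotheses (mf : measurable_fun setT f) (f0 : forall x, 0 <= f x).

(* The proof arguments only make the measure structure inferrable. *)
Definition density_measure of measurable_fun setT f & (forall x, 0 <= f x) :=
  fun A : set T => (\int[P]_(x in A) (f x)%:E)%E.
Local Notation nu := (density_measure mf f0).

Let density_measure0 : nu set0 = 0%E.
Proof. by rewrite /density_measure integral_set0. Qed.

Let density_measure_ge0 A : (0 <= nu A)%E.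
Proof. by apply: integral_ge0 => x _; rewrite lee_fin. Qed.

Let density_measure_sigma_additive : semi_sigma_additive nu.
Proof.
move=> /= F mF tF mUF; rewrite /density_measure; apply: cvg_toP.
  apply: ereal_nondecreasing_is_cvgn => k n kn.
  apply: lee_sum_nneg_natr => // i _ _.
  by apply: integral_ge0 => /= x _; rewrite lee_fin.
rewrite ge0_integral_bigcup//=.
- exact/measurable_EFinP/measurable_funTS.
- by move=> x _; rewrite lee_fin.
Qed.

HB.instance Definition _ := isMeasure.Build _ _ _ nu
  density_measure0 density_measure_ge0 density_measure_sigma_additive.

End DensityMeasure.

Section Operator.
Context (R : realType).
Local Notation T := (measurableTypeR R).
Local Notation P := (uniform_prob (@ltr01 R)).
Variable V : T * T -> R.
Hypothesis bV : bounded_mfun V.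
Hypothesis antiV : forall x y, V (x, y) = - V (y, x).
Local Notation op := (kernel_op V).

(** Skew-adjointness: Fubini exchanges the variables and [antiV] supplies the sign. *)
Lemma kernel_op_anti f g : bounded_mfun f -> bounded_mfun g ->
  \int[P]_x (op f x * g x) = - \int[P]_x (f x * op g x).
Proof.
move=> bf bg.
have bVf x : bounded_mfun (fun y => V (x, y) * f y).
  by apply: bounded_mfunM => //; exact: bounded_mfun_slice1.
have bVg x : bounded_mfun (fun y => V (x, y) * g y).
  by apply: bounded_mfunM => //; exact: bounded_mfun_slice1.
pose F (p : T * T) := V p * f p.2 * g p.1.
have bF : bounded_mfun F.
  apply: bounded_mfunM; last exact: (bounded_mfun_comp bg measurable_fst).
  by apply: bounded_mfunM => //; exact: (bounded_mfun_comp bf measurable_snd).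
transitivity (\int[P]_x \int[P]_y F (x, y)).
  by apply: eq_Rintegral => x _; rewrite /F /= RintegralZr// (bounded_mfun_integrable _ (bVf x)).
rewrite -(Rintegral_prod12 P P bF) (Rintegral_prod21 P P bF) -mulN1r -RintegralZl//; last first.
  apply: bounded_mfun_integrable; apply: bounded_mfunM => //.
  exact: bounded_mfun_kernel_op.
apply: eq_Rintegral => y _; rewrite mulrA mulN1r -RintegralZl//.
  by apply: eq_Rintegral => x _; rewrite /F /= antiV; ring.
exact: (bounded_mfun_integrable _ (bVg y)).
Qed.

Lemma kernel_op_sqr0 f : bounded_mfun f ->
  \int[P]_x (op (op f) x ^+ 2) = 0 -> \int[P]_x (op f x ^+ 2) = 0.
Proof.
move=> bf h.
have bof := bounded_mfun_kernel_op bV bf; have boof := bounded_mfun_kernel_op bV bof.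
under eq_Rintegral do rewrite expr2.
rewrite kernel_op_anti// (@ae_eq_Rintegral _ _ _ P _ (fun=> 0)).
- by rewrite Rintegral_cst// mul0r oppr0.
- exact: bounded_mfunM.
- exact: bounded_mfun_cst.
by apply: filterS (Rintegral_sqr_eq0 boof h) => x + _ => /(_ I) /= ->; rewrite mulr0.
Qed.

Lemma kernel_op_iter0 m f : bounded_mfun f ->
  \int[P]_x (iter m.+1 op f x ^+ 2) = 0 -> \int[P]_x (op f x ^+ 2) = 0.
Proof.
move=> bf; elim: m => [|m IH] h; first exact: h.
apply: IH; exact: (kernel_op_sqr0 (bounded_mfun_iter_op bV m bf) h).
Qed.

(** For almost every [w] the slice [V (u, w)] is killed by a power of [op], hence by [op] itself.
    Pairing with [g] and using skew-adjointness turns this into [op (op g) w = 0], and one more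
    reduction removes the outer [op]. *)
Lemma kernel_op_eq0 m :
  \int[prod_prob P P]_s (iter m.+1 op (fun u => V (u, s.2)) s.1) ^+ 2 = 0 ->
  forall g, bounded_mfun g -> \int[P]_x (op g x ^+ 2) = 0.
Proof.
move=> h g bg; apply: kernel_op_sqr0 => //.
have bVw w : bounded_mfun (fun u => V (u, w)) by exact: bounded_mfun_slice2.
(* Fubini needs measurability jointly in the start and the parameter [w], so each iterate is an
   integral over a third coordinate. *)
have bG : bounded_mfun (fun s : T * T => iter m.+1 op (fun u => V (u, s.2)) s.1).
  elim: m.+1 => [|k IH].
    by rewrite (_ : (fun s => _) = V)//; apply/funext => -[].
  pose K (p : (T * T) * T) := V (p.1.1, p.2) * iter k op (fun u => V (u, p.1.2)) p.2.
  apply: (@bounded_mfun_int2 _ _ _ _ _ (prod_prob P P) P K).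
  apply: bounded_mfunM.
    apply: (bounded_mfun_pt bV) => //; exact: measurableT_comp.
  apply: (bounded_mfun_comp (g := fun p : (T * T) * T => (p.2, p.1.2)) IH).
  by apply: measurable_fun_pair => //; exact: measurableT_comp.
have bG2 : bounded_mfun (fun s : T * T => (iter m.+1 op (fun u => V (u, s.2)) s.1) ^+ 2).
  exact: (bounded_mfunM bG bG).
move: h; rewrite (Rintegral_prod21 P P bG2) => /Rintegral_ge0_eq0.
move=> /(_ (bounded_mfun_int1 P P bG2)) h.
have {}h := h (fun w => Rintegral_ge0 _ (fun x _ => sqr_ge0 _)).
have bog := bounded_mfun_kernel_op bV bg; have boog := bounded_mfun_kernel_op bV bog.
rewrite (@ae_eq_Rintegral _ _ _ P _ (fun=> 0)).
- by rewrite Rintegral_cst// mul0r.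
- exact: (bounded_mfunM boog boog).
- exact: bounded_mfun_cst.
apply: filterS h => w + _ => /(_ I) /= /(kernel_op_iter0 (bVw w)) hw.
have boV := bounded_mfun_kernel_op bV (bVw w).
suff -> : op (op g) w = 0 by rewrite expr0n.
(* Antisymmetry enters twice, once in moving [op] to the slice and once in turning [V (w, y)] into
   [V (y, w)]; the signs cancel. *)
have -> : op (op g) w = \int[P]_x (op (fun u => V (u, w)) x * g x).
  rewrite kernel_op_anti// -mulN1r -RintegralZl//.
    by apply: eq_Rintegral => y _; rewrite antiV; ring.
  exact: (bounded_mfun_integrable _ (bounded_mfunM (bVw w) bog)).
rewrite (@ae_eq_Rintegral _ _ _ P _ (fun=> 0)).
- by rewrite Rintegral_cst// mul0r.
- exact: bounded_mfunM.
- exact: bounded_mfun_cst.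
by apply: filterS (Rintegral_sqr_eq0 boV hw) => x + _ => /(_ I) /= ->; rewrite mul0r.
Qed.

Hypothesis V_ge : forall p, 0 <= 1 + V p.

(** Uniqueness of the product measure concerns measures, not signed ones. This is why [V] is shifted
    by 1 and [V_ge] is assumed. *)
Lemma kernel_ae_eq0 : (forall g, bounded_mfun g -> \int[P]_x (op g x ^+ 2) = 0) ->
  ae_eq (P \x P)%E setT V (cst 0).
Proof.
move=> op0.
pose PP := prod_prob P P.
have m1V : measurable_fun setT (fun p => 1 + V p).
  by apply: measurable_funD; [exact: measurable_cst | case: bV].
(* The integral over a rectangle is that of [op] of the indicator of [B] over [A]. *)
have rect A B : measurable A -> measurable B -> \int[PP]_p (\1_(A `*` B) p * V p) = 0.
  move=> mA mB.
  have b1 (C : set T) : measurable C -> bounded_mfun (\1_C : T -> R) by exact: bounded_mfun_indic.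
  pose F (p : T * T) := \1_A p.1 * (V p * \1_B p.2) : R.
  have bF : bounded_mfun F.
    apply: bounded_mfunM; first exact: (bounded_mfun_comp (b1 A mA) measurable_fst).
    by apply: bounded_mfunM => //; exact: (bounded_mfun_comp (b1 B mB) measurable_snd).
  transitivity (\int[PP]_p F p).
    apply: eq_Rintegral => -[x y] _; rewrite /F !indicE in_setX /=.
    by case: (x \in A); case: (y \in B); rewrite ?mul1r ?mulr1 ?mul0r ?mulr0.
  rewrite (Rintegral_prod12 P P bF) /F /=.
  rewrite (@ae_eq_Rintegral _ _ _ P _ (fun=> 0)).
  - by rewrite Rintegral_cst// mul0r.
  - exact: (bounded_mfun_int2 P P bF).
  - exact: bounded_mfun_cst.
  have := Rintegral_sqr_eq0 (bounded_mfun_kernel_op bV (b1 B mB)) (op0 _ (b1 B mB)).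
  apply: filterS => x + _ => /(_ I) /= h.
  rewrite RintegralZl//; first by rewrite [X in _ * X]h mulr0.
  apply: bounded_mfun_integrable; apply: bounded_mfunM (b1 B mB).
  exact: bounded_mfun_slice1.
have E1 A : measurable A ->
    density_measure PP m1V V_ge A = (PP A + (\int[PP]_p (\1_A p * V p))%:E)%E.
  move=> mA; rewrite /density_measure.
  have bA : bounded_mfun (\1_A : _ -> R) by exact: bounded_mfun_indic.
  rewrite (EFin_Rintegral PP (bounded_mfunM bA bV)).
  rewrite integral_mkcond.
  have PA : (\int[PP]_p (\1_A p)%:E)%E = PP A.
    by rewrite integral_indic; [rewrite setIT | exact: measurableT | exact: mA].
  rewrite -PA.
  rewrite -integralD//; last 2 first.
  - exact: bounded_mfun_integrable.
  - exact: (bounded_mfun_integrable _ (bounded_mfunM bA bV)).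
  apply: eq_integral => p _; rewrite patchE indicE -EFinD; case: (p \in A) => /=.
    by rewrite mul1r.
  by rewrite mul0r addr0.
have E2 A : measurable A -> density_measure PP m1V V_ge A = PP A.
  move=> mA; apply/esym; apply: (product_measure_unique (m' := density_measure PP m1V V_ge)) => //.
  move=> B C mB mC; rewrite [LHS]E1; last exact: measurableX.
  by rewrite rect// adde0 [LHS]product_measure1E.
(* The measure of [A] is finite, so it cancels. *)
have E3 A : measurable A -> \int[PP]_p (\1_A p * V p) = 0.
  move=> mA; have := E1 A mA; rewrite E2// => /esym/eqP.
  have Afin : PP A \is a fin_num by exact: fin_num_measure.
  rewrite -[X in _ == X]adde0; move: Afin; case: (PP A) => // r _.
  by rewrite -!EFinD => /eqP[/addrI].
have : ae_eq PP setT (EFin \o V) (cst 0%E).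
  apply: integral_ae_eq => //; first exact: bounded_mfun_integrable.
  move=> E _ mE; rewrite integral0.
  have bE : bounded_mfun (\1_E : _ -> R) by exact: bounded_mfun_indic.
  transitivity (\int[PP]_p (\1_E p * V p)%:E)%E; last first.
    by rewrite -(EFin_Rintegral PP (bounded_mfunM bE bV)) E3.
  rewrite integral_mkcond; apply: eq_integral => p _.
  by rewrite patchE indicE; case: (p \in E); rewrite ?mul1r ?mul0r.
by apply: filterS => p + _ => /(_ I) [].
Qed.

End Operator.

(** * The main expansion *)

Section Expansion.
Context (R : realType).
Local Notation T := (measurableTypeR R).
Local Notation P := (uniform_prob (@ltr01 R)).
Local Notation mu := (@lebesgue_measure R).

Lemma prod_1add_powerset (I : finType) (E : {set I}) (v : I -> R) :
  \prod_(e in E) (1 + v e) = \sum_(F in powerset E) \prod_(e in F) v e.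
Proof.
(* Indices outside [E] get the value 0, so in the expansion over all subsets of [I] only those
   inside [E] survive. *)
transitivity (\prod_e ((if e \in E then v e else 0) + 1)).
  by rewrite big_mkcond; apply: eq_bigr => e _; case: ifP; rewrite ?add0r// addrC.
rewrite bigA_distr /= [RHS]big_mkcond; apply: eq_bigr => F _.
rewrite powersetE; case: ifPn => [/fintype.subsetP FE|/fintype.subsetPn[e eF eE]].
  rewrite [RHS]big_mkcond; apply: eq_bigr => e _.
  by case: ifP => // /FE ->.
by rewrite (bigD1 e) //= eF (negbTE eE) mul0r.
Qed.

Lemma edges_spanning (C : ograph) (F : {set C * C}) :
  F \subset edges C -> edges (spanning F) = F.
Proof.
move=> FE; apply/setP => -[a b]; rewrite !inE /= /span_arc.
by apply/andP/idP => [[]//|ab]; split=> //; move/fintype.subsetP: FE => /(_ _ ab); rewrite inE.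
Qed.

Lemma density_expansion (C : ograph) (V : T * T -> R) : bounded_mfun V ->
  density C (fun p => (1 + V p) / 2) =
  2 ^- #|edges C| * \sum_(F in powerset (edges C)) density (spanning F) V.
Proof.
move=> bV.
have bV' : bounded_mfun (fun p => (1 + V p) / 2).
  apply: bounded_mfunM; last exact: bounded_mfun_cst.
  by apply: bounded_mfunD => //; exact: bounded_mfun_cst.
rewrite (density_iid bV' (iid_cube R C)).
pose A (F : {set C * C}) := fun x : #|C|.-tuple T =>
  @arc_prod _ (spanning F) V (fun v => tnth x (enum_rank v)).
have bA F : bounded_mfun (A F).
  by apply: bounded_mfun_arc_prod => // v; exact: measurable_tnth.
transitivity (\int[cube_measure R #|C|]_x (2 ^- #|edges C| *
    \sum_(F in powerset (edges C)) A F x)).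
  apply: eq_Rintegral => x _; rewrite /A /arc_prod.
  rewrite big_split /= prodr_const -exprVn mulrC; congr (_ * _).
  rewrite prod_1add_powerset; apply: eq_bigr => F.
  by rewrite powersetE => FE; rewrite (edges_spanning FE).
rewrite RintegralZl//; last first.
  by apply: bounded_mfun_integrable; exact: bounded_mfun_sum.
congr (_ * _); rewrite Rintegral_sum//; apply: eq_bigr => F _.
by rewrite (@density_iid _ (spanning F) _ _ _ _ _ bV (iid_cube R C)).
Qed.

Lemma uniform_prob_lebesgue (B : set T) : measurable B -> B `<=` @unit_itv R -> P B = mu B.
Proof.
move=> mB Bu; rewrite /uniform_prob -[RHS]mul1e -integral_cst//.
apply: eq_integral => x; rewrite inE => /Bu /= x01.
by rewrite /uniform_pdf x01 subr0 invr1.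
Qed.

(** [quasirandom_forcing] is stated with Lebesgue measure on the plane, the argument with the
    uniform probability. Inside the unit square they agree section by section. *)
Lemma uniform_prob_null (N : set (T * T)) : measurable N -> N `<=` @unit_square R ->
  (P \x P)%E N = 0%E -> (mu \x mu)%E N = 0%E.
Proof.
move=> mN Nu; rewrite /product_measure1 /=.
have msec x : measurable (xsection N x) by exact: measurable_xsection.
have secu x : xsection N x `<=` @unit_itv R.
  by move=> y; rewrite /xsection /= inE => /Nu [].
rewrite integral_uniform//; last exact: measurable_fun_xsection.
rewrite subr0 invr1 mul1e => <-.
rewrite [RHS]integral_mkcond; apply: eq_integral => x _ /=.
rewrite patchE; case: ifPn => [_|]; first by rewrite /= uniform_prob_lebesgue.
rewrite notin_setE /= in_itv /= => xu.
rewrite (_ : xsection N x = set0) ?measure0//.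
apply/seteqP; split => // y; rewrite /xsection /= inE => /Nu [] /=.
by move=> h _; apply: xu.
Qed.

End Expansion.

(** * Sums over classes of isomorphic spanning subgraphs *)

Section ClassSum.
Context (R : realType).
Local Notation T := (measurableTypeR R).
Variable V : T * T -> R.
Hypothesis bV : bounded_mfun V.
Hypothesis antiV : forall x y, V (x, y) = - V (y, x).
Variable C : ograph.

(** Isolated vertices carry no arcs, so the reversed arcs all come from [G]. *)
Lemma uiso_reversal_isolated (G H : ograph) m :
  uiso H (disjoint_union G (isolated m)) -> exists b, reversal_isolated b G H.
Proof.
case/uiso_reversal => b [X [XE _ HX]].
pose X0 := [set e : G * G | (inl e.1, inl e.2) \in X]%SET.
exists (odd #|X0|), X0, m; split => //.
  apply/fintype.subsetP => e; rewrite !inE => /(fintype.subsetP XE).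
  by rewrite inE.
case: HX => f bf ff; exists f => // x y; rewrite -ff.
case: (f x) => u; case: (f y) => v //=; rewrite /rev_arc /= ?inE //=.
Qed.

Lemma reversal_isolated_uiso b (G H : ograph) : reversal_isolated b G H ->
  exists m, uiso H (disjoint_union G (isolated m)).
Proof.
case=> X [m [XE _ /isomorphic_uiso HX]]; exists m.
exact: uiso_trans HX (uiso_union (uiso_reverse X) (uiso_refl _)).
Qed.

Lemma card_uiso (G H : ograph) : uiso G H -> #|G| = #|H|.
Proof. by case=> f /bij_eq_card. Qed.

Lemma card_union_isolated (G : ograph) m : #|disjoint_union G (isolated m)| = (#|G| + m)%N.
Proof. by rewrite card_sum card_ord. Qed.

(* If [spanning F] is both an even and an odd reversal of [Q_union s], then both
   densities vanish, so no uniqueness of the parity is needed. *)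
Lemma class_sum (F0 : {set C * C}) (s : seq nat) m :
  uiso (spanning F0) (disjoint_union (Q_union s) (isolated m)) ->
  \sum_(F in powerset (edges C) | `[< uiso (spanning F) (spanning F0) >])
    density (spanning F) V = (alpha C s)%:~R * density (Q_union s) V.
Proof.
move=> h0.
pose e b (F : {set C * C}) := `[< reversal_isolated b (Q_union s) (spanning F) >].
have cnt b : (#|[set F : {set C * C} | (F \subset edges C) && e b F]%SET|%:Z)%:~R =
    \sum_(F in powerset (edges C)) (e b F)%:R :> R.
  rewrite -sum1_card -pmulrn natr_sum big_mkcond /= [RHS]big_mkcond /=.
  by apply: eq_bigr => F _; rewrite !inE; case: (F \subset _) => //=; case: (e b F).
rewrite /alpha /= intrB !cnt -sumrB mulr_suml.
rewrite [LHS]big_mkcondr /=.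
apply: eq_bigr => F _; case: asboolP => [hF|nF].
  have sgn b : e b F -> density (spanning F) V = (-1) ^+ b * density (Q_union s) V.
    by move=> /asboolP; exact: density_reversal_isolated.
  have [b /asboolP eb] := uiso_reversal_isolated (uiso_trans hF h0).
  have ee : e false F || e true F by case: b eb => eb; rewrite /e eb ?orbT.
  move: ee; have [ef|_] := boolP (e false F); have [et|_] := boolP (e true F) => // _.
  - have := sgn true et; rewrite (sgn false ef) expr0 expr1 subrr mul0r mul1r mulN1r; lra.
  - by rewrite (sgn false ef) expr0 subr0.
  - by rewrite (sgn true et) expr1 sub0r.
have ne b : e b F = false.
  apply/negbTE/negP => /asboolP /reversal_isolated_uiso [m' hm']; apply: nF.
  (* All spanning subgraphs have the vertex set of [C], which forces the number of isolated
     vertices. *)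
  suff mm : m' = m by apply: uiso_trans hm' _; rewrite mm; exact: uiso_sym.
  apply: (@addnI #|Q_union s|).
  by rewrite -!card_union_isolated -(card_uiso hm') -(card_uiso h0).
by rewrite !ne subrr mul0r.
Qed.

Variable b : bool.
Hypothesis C_cycle : oriented_cycle C.
Hypothesis alpha_sign : forall s : seq nat, (0 < size s)%N -> all (fun n => 0 < n)%N s ->
  0 <= (-1) ^+ b * alpha C s.

Lemma class_sum_sign (F0 : {set C * C}) : F0 != finset.set0 -> (F0 \proper edges C)%SET ->
  0 <= (-1) ^+ b * \sum_(F in powerset (edges C) | `[< uiso (spanning F) (spanning F0) >])
    density (spanning F) V.
Proof.
move=> F0n0 F0E.
have [p hp] := spanning_cycle_lin_graph C_cycle F0E.
have [s hs] := lin_graph_path_union #|C| p.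
have h0 := uiso_trans hp hs.
have [odd_s|even_s] := boolP (has odd s).
  rewrite big1 ?mulr0// => F /andP[_ /asboolP hF].
  apply: (density_uiso_eq0 bV antiV (uiso_trans hF h0)).
  exact: density_path_union_odd.
have sE : s = map double (map half s).
  rewrite -map_comp -[LHS]map_id; apply/eq_in_map => n ns /=.
  by rewrite even_halfK//; move: even_s; rewrite -all_predC => /allP/(_ _ ns).
rewrite sE in h0.
have [m hm] := Q_union_filter (map half s).
move: hm; set t := [seq n <- _ | _] => hm.
have {h0 hm}h0 := uiso_trans (uiso_trans h0 (path_union_even _)) hm.
rewrite (class_sum h0) mulrA.
rewrite mulr_ge0 ?density_Q_union_ge0//.
rewrite (_ : (-1) ^+ b * _ = ((-1) ^+ b * alpha C t)%:~R :> R); last first.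
  by rewrite intrM rmorphXn /= rmorphN1.
rewrite ler0z alpha_sign//; last exact: filter_all.
(* If no positive length were left, [F0] would have no edges. *)
rewrite lt0n; apply: contra F0n0 => /nilP t0.
have /esym := card_edges_uiso h0; rewrite t0 edges_spanning ?proper_sub// => c0.
rewrite -cards_eq0 -c0 cards_eq0; apply/eqP/setP => -[x y].
by rewrite !inE /=; case: x => [[]|] //; case: y.
Qed.

Lemma proper_sum_sign :
  0 <= (-1) ^+ b * \sum_(F in powerset (edges C) | (F != finset.set0) && (F != edges C))
    density (spanning F) V.
Proof.
pose rel (F F' : {set C * C}) := `[< uiso (spanning F) (spanning F') >].
(* A canonical representative of each class turns the equivalence into an equality, as
   [partition_big] requires. *)
pose r F := odflt F [pick F' | rel F F'].
have rP F : rel F (r F).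
  by rewrite /r; case: pickP => //= _; apply/asboolP; exact: uiso_refl.
have rE F F' : rel F F' -> r F = r F'.
  move=> /asboolP h; rewrite /r.
  have -> : [pick F'' | rel F F''] = [pick F'' | rel F' F''].
    apply: eq_pick => F''; apply/asboolP/asboolP => h'.
      exact: uiso_trans (uiso_sym h) h'.
    exact: uiso_trans h h'.
  by case: pickP => //= /(_ F'); rewrite /rel asboolT //; exact: uiso_refl.
rewrite (partition_big r xpredT) //= mulr_sumr; apply: sumr_ge0 => j _.
have [F0 /andP[/and3P[F0E F0n0 F0nE] /eqP r0]|none] :=
  pickP (fun F => [&& F \in powerset (edges C), F != finset.set0 & F != edges C] &&
                  (r F == j)); last first.
  by rewrite big_pred0 ?mulr0.
rewrite powersetE in F0E.
have F0p : (F0 \proper edges C)%SET by rewrite finset.properEneq F0nE.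
rewrite (eq_bigl (fun F => (F \in powerset (edges C)) && `[< uiso (spanning F) (spanning F0) >])).
  exact: class_sum_sign.
move=> F; rewrite powersetE; apply/idP/idP.
  move=> /andP[/and3P[FE _ _] /eqP rF]; rewrite FE /=; apply/asboolP.
  have /asboolP h := rP F; have /asboolP h' := rP F0.
  by rewrite rF in h; rewrite r0 in h'; exact: uiso_trans h (uiso_sym h').
move=> /andP[FE hF]; rewrite FE (rE _ _ hF) r0 eqxx andbT /=.
(* Equal edge counts keep the whole class away from the empty set and from [edges C]. *)
have cF : #|F| = #|F0|.
  by move/asboolP/card_edges_uiso: hF; rewrite !edges_spanning.
rewrite -!cards_eq0 in F0n0 *; rewrite cF F0n0 /=.
by apply: contraTneq (fintype.proper_card F0p) => <-; rewrite cF ltnn.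
Qed.

End ClassSum.

(** * The forcing argument for both signs *)

(** The same sign [(-1) ^+ b] governs the full cycle, through the reversal of [D], and the path
    classes, through [alpha]; both halves of the theorem thus become one argument. *)
Lemma signed_forcing (R : realType) (C : ograph) (b : bool) :
  oriented_cycle C -> reversal b (D #|C|./2) C -> (3 < #|C|)%N ->
  (forall s : seq nat, (0 < size s)%N -> all (fun n => 0 < n)%N s ->
      0 <= (-1) ^+ b * alpha C s) ->
  quasirandom_forcing R C.
Proof.
move=> Cc revC C4 alphaC W [[mW [M WM]] W0 W1] dW.
have mU : measurable (@unit_square R) by apply: measurableX; exact: measurable_unit_itv.
(* Extension by 0 makes boundedness, antisymmetry and [0 <= 1 + V p] hold everywhere, not only on
   the square. *)
pose V := (fun p => 2 * W p - 1) \_ (@unit_square R).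
have VE p : unit_square p -> V p = 2 * W p - 1 by move=> up; rewrite /V patchE mem_set.
have V0 p : ~ unit_square p -> V p = 0 by move=> up; rewrite /V patchE memNset.
have bV : bounded_mfun V.
  split.
    apply/(measurable_restrictT _ mU); apply: measurable_funB => //.
    exact: measurable_funM.
  exists (2 * `|M| + 1) => p; have [up|up] := pselect (unit_square p); last first.
    by rewrite V0// normr0 addr_ge0// mulr_ge0.
  rewrite VE// (le_trans (ler_normB _ _))// normr1 lerD2r normrM ger0_norm// ler_pM2l//.
  by rewrite (le_trans (WM _ up))// ler_norm.
have antiV x y : V (x, y) = - V (y, x).
  have [[ux uy]|up] := pselect (@unit_square R (x, y)).
    by rewrite !VE//; have := W1 x y ux uy; lra.
  by rewrite !V0 ?oppr0// => -[ux uy]; apply: up.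
have V1 p : 0 <= 1 + V p.
  have [up|up] := pselect (unit_square p); last by rewrite V0// addr0.
  by rewrite VE//; have := W0 p up; lra.
have sum1 : \sum_(F in powerset (edges C)) density (spanning F) V = 1.
  have := density_expansion C bV.
  rewrite -(@eq_density _ C W) ?dW; last by move=> p up; rewrite VE//; field.
  by rewrite -[LHS]mulr1 => /mulfI ->//; rewrite invr_eq0 expf_neq0.
have E0 : edges C != finset.set0.
  case: Cc => _ [f _ ff].
  pose i : 'I_#|C| := Ordinal (ltn_trans (isT : (0 < 3)%N) C4).
  apply/eqP => /setP E0; have := ff i (ordS i); rewrite eqxx /= => /orP[] h.
    by have := E0 (f i, f (ordS i)); rewrite !inE /= h.
  by have := E0 (f (ordS i), f i); rewrite !inE /= h.
have dE : density (spanning (edges C)) V = (-1) ^+ b * density (D #|C|./2) V.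
  rewrite -(density_reversal bV antiV revC); apply: density_iso => //.
  exists id; first exact: (inv_bij (fun=> erefl)).
  by move=> x y; rewrite /= /span_arc inE /= andbb.
move: sum1; rewrite (bigD1 finset.set0) ?powersetE ?finset.sub0set//=.
rewrite (density_no_edges bV) ?edges_spanning ?finset.sub0set//.
rewrite (bigD1 (edges C)) ?powersetE ?subxx ?E0//= dE.
rewrite -[RHS]addr0 => /addrI.
have := proper_sum_sign bV antiV Cc alphaC.
rewrite (eq_bigl _ _ (fun F => andbA _ _ _)).
set S := \sum_(F | _) _ => S0 dS.
have [m mE m0] : exists2 m, #|C|./2 = m.+1 & (0 < m)%N.
  by exists (#|C|./2).-1; lia.
rewrite mE in dS.
have d0 : density (D m.+1) V = 0.
  (* After multiplication by [(-1) ^+ b], both terms of [dS] are nonnegative and their sum is 0. *)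
  have := density_D_ge0 bV m0.
  case: (b) S0 dS; rewrite ?expr0 ?expr1 ?mul1r ?mulN1r; lra.
have VP : ae_eq (uniform_prob (@ltr01 R) \x uniform_prob (@ltr01 R))%E setT V (cst 0).
  apply: kernel_ae_eq0 => //.
  (* Length at least 4 means that [op] is applied at least once in [density_D], as [kernel_op_eq0]
     requires. *)
  case: m m0 d0 {mE dS} => // m m0 d0.
  by apply: (kernel_op_eq0 bV antiV (m := m)); rewrite -density_D.
pose N := [set p | V p <> 0].
have mN : measurable N.
  have := measurableC (bV.1 measurableT [set 0] (measurable_set1 _)).
  by rewrite setTI.
exists N; split => //.
- apply: uniform_prob_null => //.
    by move=> p Np; apply: contrapT => /V0.
  pose P := uniform_prob (@ltr01 R).
  apply: (iffLR (negligibleP (prod_prob P P) mN)); apply: negligibleS VP.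
  by move=> p Np /= /(_ I).
- move=> p /= /not_implyP[up Wp]; rewrite /N /= VE// => h; apply: Wp; lra.
Qed.

Theorem theorem7 (R : realType) (C : ograph) :
  oriented_cycle C -> ~~ odd #|C| ->
  (gamma C = 1 ->
   (forall s : seq nat, (0 < size s)%N -> all (fun n => 0 < n)%N s ->
      0 <= alpha C s) ->
   quasirandom_forcing R C) /\
  (gamma C = -1 ->
   (forall s : seq nat, (0 < size s)%N -> all (fun n => 0 < n)%N s ->
      alpha C s <= 0) ->
   quasirandom_forcing R C).
Proof.
move=> Cc evenC.
have C4 : (3 < #|C|)%N by case: (Cc) => C3 _; move: evenC C3; lia.
have [b revC] := uiso_reversal (oriented_cycle_D Cc evenC).
(* For [gamma C = 1] the even reversal is [revF] itself; for [gamma C = -1] an even one is excluded,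
   so the parity [b] found above is odd. *)
rewrite /gamma; case: asboolP => revF; split=> // _ alphaC.
  apply: (signed_forcing (b := false)) => // s s0 sp.
  by rewrite expr0 mul1r alphaC.
apply: (signed_forcing (b := true)) => //; first by case: b revC.
by move=> s s0 sp; rewrite expr1 mulN1r oppr_ge0 alphaC.
Qed.
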